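(* Let $X$ be a rational variety over an algebraically closed field $\Bbbk$ and let $T$ be an irreducible affine variety. If $\varphi:T\to\mathrm{Bir}(X)$ is a morphism and $C\subset T$ is a constructible set, then $\varphi(C)$ is constructible in $\mathrm{Bir}(X)$ (for the Zariski topology) and contains a dense open subset of its closure $\overline{\varphi(C)}$.
   Context: For an irreducible variety $X$ over $\Bbbk$, $\mathrm{Bir}(X)$ is the group of birational maps $X\dashrightarrow X$. For a variety $T$, a pseudo-automorphism of $T\times X$ over $T$ is a birational map $\varphi:T\times X\dashrightarrow T\times X$ for which there is a dense open $U\subset T\times X$ such that: $\varphi$ is defined on $U$; $U_t:=U\cap(\{t\}\times X)$ is dense in $\{t\}\times X$ for all $t\in T$; and there is a morphism $f:U\to X$ with $\varphi|_U(t,x)=(t,f(t,x))$ and $\varphi|_{U_t}:U_t\to\{t\}\times X$ a birational morphism for every $t$. The induced map $T\to\mathrm{Bir}(X)$, $t\mapsto\varphi_t$ (also written $\varphi(t)$), is called a morphism from $T$ to $\mathrm{Bir}(X)$. Zariski topology on $\mathrm{Bir}(X)$: $\mathcal{F}\subset\mathrm{Bir}(X)$ is closed iff $\varphi^{-1}(\mathcal{F})$ is closed in $T$ for every variety $T$ and every morphism $\varphi:T\to\mathrm{Bir}(X)$ (it is equivalent to use only affine irreducible $T$). A subset of a topological space is constructible if it is a finite union of locally closed subsets. *)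

(* Defs.v *)
From HB Require Import structures.
From mathcomp Require Import all_boot all_order all_algebra.
From mathcomp Require Import all_classical topology.
(* The notations of mpoly clash with those of analysis. *)
From mathcomp Require mpoly.
Import (canonicals, coercions) mpoly.

Set Implicit Arguments.
Unset Strict Implicit.
Unset Printing Implicit Defensive.

Import GRing.Theory.
Local Open Scope classical_set_scope.
Local Open Scope ring_scope.

(* Varieties are classical ones, in the sense of Serre: a space of closed     *)
(* points with a sheaf of k-valued functions that is locally affine.  The     *)
(* sheaf is given by the predicate "f is regular at x"; a section over an     *)
(* open U is a function regular at each point of U.  Sections are represented *)
(* by total functions, whose values off U are irrelevant by regular_germ.     *)
Record kspace (k : fieldType) := KSpace {
  carrier :> topologicalType;
  regular_at : carrier -> (carrier -> k) -> Prop;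
  regular_near : forall x f, regular_at x f -> \forall y \near x, regular_at y f;
  regular_germ : forall x f g,
    (\forall y \near x, f y = g y) -> regular_at x f -> regular_at x g;
  regular_cst : forall x (c : k), regular_at x (fun=> c);
  regular_add : forall x f g, regular_at x f -> regular_at x g ->
    regular_at x (fun y => f y + g y);
  regular_mul : forall x f g, regular_at x f -> regular_at x g ->
    regular_at x (fun y => f y * g y);
  regular_neq0 : forall x f, regular_at x f -> f x != 0 ->
    \forall y \near x, f y != 0;
  regular_inv : forall x f, regular_at x f -> f x != 0 ->
    regular_at x (fun y => (f y)^-1)
}.

Section AffineSpace.
Variables (k : fieldType) (n : nat).

Definition affine_point : Type := 'rV[k]_n.
HB.instance Definition _ := Choice.copy affine_point 'rV[k]_n.

Definition peval (p : mpoly.mpoly n k) (x : affine_point) : k :=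
  mpoly.meval (fun i => (x : 'rV[k]_n) ord0 i) p.

Definition zero_locus (S : set (mpoly.mpoly n k)) : set affine_point :=
  [set x | forall p, S p -> peval p x = 0].

Definition affine_open : set_system affine_point :=
  [set W | exists S, W = ~` zero_locus S].

Lemma affine_openP W : affine_open W <->
  forall x, W x -> exists2 p, peval p x != 0 & forall y, peval p y != 0 -> W y.
Proof.
split=> [[S ->] x /= /existsNP[p /not_implyP[Sp /eqP px0]]|H].
  by exists p => // y py0 /(_ p Sp) /eqP; apply/negP.
exists [set p | forall y, peval p y != 0 -> W y]; apply/seteqP; split=> x.
  by move=> /H[p px0 pW] /(_ p pW) /eqP; apply/negP.
by move=> /= /existsNP[p /not_implyP[pW /eqP]]; exact: pW.
Qed.

Lemma pevalM (p q : mpoly.mpoly n k) x : peval (p * q) x = peval p x * peval q x.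
Proof. exact: rmorphM. Qed.

Lemma pevalD (p q : mpoly.mpoly n k) x : peval (p + q) x = peval p x + peval q x.
Proof. exact: rmorphD. Qed.

Lemma peval1 x : peval 1 x = 1.
Proof. exact: rmorph1. Qed.

Lemma affine_openT : affine_open setT.
Proof. by apply/affine_openP => x _; exists (1 : mpoly.mpoly n k); rewrite ?peval1 ?oner_eq0. Qed.

Lemma affine_openI : setI_closed affine_open.
Proof.
move=> A B /affine_openP HA /affine_openP HB; apply/affine_openP => x [Ax Bx].
have [p px pA] := HA _ Ax; have [q qx qB] := HB _ Bx.
exists ((p : mpoly.mpoly n k) * q); first by rewrite pevalM mulf_neq0.
by move=> y; rewrite pevalM mulf_eq0 negb_or => /andP[/pA ? /qB].
Qed.

Lemma affine_open_bigU (I : Type) (f : I -> set affine_point) :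
  (forall i, affine_open (f i)) -> affine_open (\bigcup_i f i).
Proof.
move=> Hf; apply/affine_openP => x [i _ fix_].
have /affine_openP/(_ _ fix_)[p px pf] := Hf i.
by exists p => // y /pf ?; exists i.
Qed.

HB.instance Definition _ := isOpenTopological.Build affine_point
  affine_openT affine_openI affine_open_bigU.

Definition affine_regular_at (x : affine_point) (f : affine_point -> k) :=
  exists p q, peval q x != 0 /\ \forall y \near x, f y = peval p y / peval q y.

Lemma peval_neq0 (p : mpoly.mpoly n k) (x : affine_point) : peval p x != 0 -> \forall y \near x, peval p y != 0.
Proof.
move=> px0; suff o : open [set y | peval p y != 0] by exact: (open_nbhs_nbhs (conj o px0)).
by apply/affine_openP => y py; exists p.
Qed.

Fact affine_regular_near x f : affine_regular_at x f ->
  \forall y \near x, affine_regular_at y f.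
Proof.
move=> [p [q [qx /near_join fE]]].
by near=> y; exists p, q; split; [near: y; exact: peval_neq0 | near: y].
Unshelve. all: by end_near. Qed.

Fact affine_regular_germ x f g : (\forall y \near x, f y = g y) ->
  affine_regular_at x f -> affine_regular_at x g.
Proof.
move=> fg [p [q [qx fE]]]; exists p, q; split=> //.
by apply: filterS2 fg fE => y ->.
Qed.

Fact affine_regular_cst x c : affine_regular_at x (fun=> c).
Proof.
exists (mpoly.mpolyC n c), 1; rewrite peval1 oner_eq0; split=> //.
by near=> y; rewrite peval1 divr1 /peval mpoly.mevalC.
Unshelve. all: by end_near. Qed.

Fact affine_regular_add x f g : affine_regular_at x f ->
  affine_regular_at x g -> affine_regular_at x (fun y => f y + g y).
Proof.
move=> [p [q [qx fE]]] [r [s [sx gE]]].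
exists (p * s + r * q), (q * s); rewrite pevalM mulf_neq0//; split=> //.
have := peval_neq0 sx; have := peval_neq0 qx.
move=> qn sn; near=> y; rewrite !(pevalM, pevalD) -addf_div; last 2 first.
- by near: y.
- by near: y.
by congr (_ + _); near: y.
Unshelve. all: by end_near. Qed.

Fact affine_regular_mul x f g : affine_regular_at x f ->
  affine_regular_at x g -> affine_regular_at x (fun y => f y * g y).
Proof.
move=> [p [q [qx fE]]] [r [s [sx gE]]].
exists (p * r), (q * s); rewrite pevalM mulf_neq0//; split=> //.
by apply: filterS2 fE gE => y -> ->; rewrite !pevalM mulf_div.
Qed.

Fact affine_regular_neq0 x f : affine_regular_at x f -> f x != 0 ->
  \forall y \near x, f y != 0.
Proof.
move=> [p [q [qx fE]]] fx.
have px : peval p x != 0.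
  by move: fx; rewrite (nbhs_singleton fE) mulf_eq0 negb_or => /andP[].
have := peval_neq0 px; have := peval_neq0 qx; move=> qn pn.
near=> y; have -> : f y = peval p y / peval q y by near: y.
by rewrite mulf_neq0 ?invr_eq0//; near: y.
Unshelve. all: by end_near. Qed.

Fact affine_regular_inv x f : affine_regular_at x f -> f x != 0 ->
  affine_regular_at x (fun y => (f y)^-1).
Proof.
move=> [p [q [qx fE]]] fx; exists q, p; split.
  by move: fx; rewrite (nbhs_singleton fE) mulf_eq0 negb_or => /andP[].
by apply: filterS fE => y ->; rewrite invf_div.
Qed.

Definition affine_space : kspace k := KSpace affine_regular_near
  affine_regular_germ affine_regular_cst affine_regular_add affine_regular_mul
  affine_regular_neq0 affine_regular_inv.

End AffineSpace.

(* Induced structure on a subset: its functions are locally the restrictions  *)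
(* of regular functions.  On a closed subset this is the reduced structure.   *)
Section Subspace.
Variables (k : fieldType) (X : kspace k) (A : set X).

Definition sub_regular_at (x : A) (f : A -> k) :=
  exists g : X -> k, regular_at (set_val x) g /\
    \forall y \near x, f y = g (set_val y).

Fact near_set_val (x : A) (P : X -> Prop) :
  (\forall y \near set_val x, P y) -> \forall y \near x, P (set_val y).
Proof. by move=> HP; exact: (@initial_continuous A X set_val x P HP). Qed.

Fact sub_regular_near x f : sub_regular_at x f ->
  \forall y \near x, sub_regular_at y f.
Proof.
move=> [g [/regular_near/near_set_val gx /near_join fE]].
by apply: filterS2 gx fE => y gy fy; exists g.
Qed.

Fact sub_regular_germ x f g : (\forall y \near x, f y = g y) ->
  sub_regular_at x f -> sub_regular_at x g.
Proof.
move=> fg [h [hx fh]]; exists h; split=> //.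
by apply: filterS2 fg fh => y ->.
Qed.

Fact sub_regular_cst x c : sub_regular_at x (fun=> c).
Proof. by exists (fun=> c); split; [exact: regular_cst|near=> y].
Unshelve. all: by end_near. Qed.

Fact sub_regular_add x f g : sub_regular_at x f -> sub_regular_at x g ->
  sub_regular_at x (fun y => f y + g y).
Proof.
move=> [f' [rf fE]] [g' [rg gE]]; exists (fun y => f' y + g' y).
split; first exact: regular_add.
by apply: filterS2 fE gE => y -> ->.
Qed.

Fact sub_regular_mul x f g : sub_regular_at x f -> sub_regular_at x g ->
  sub_regular_at x (fun y => f y * g y).
Proof.
move=> [f' [rf fE]] [g' [rg gE]]; exists (fun y => f' y * g' y).
split; first exact: regular_mul.
by apply: filterS2 fE gE => y -> ->.
Qed.

Fact sub_regular_neq0 x f : sub_regular_at x f -> f x != 0 ->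
  \forall y \near x, f y != 0.
Proof.
move=> [g [rg fE]]; rewrite (nbhs_singleton fE) => gx.
have /near_set_val gn := regular_neq0 rg gx.
by apply: filterS2 fE gn => y ->.
Qed.

Fact sub_regular_inv x f : sub_regular_at x f -> f x != 0 ->
  sub_regular_at x (fun y => (f y)^-1).
Proof.
move=> [g [rg fE]]; rewrite (nbhs_singleton fE) => gx.
exists (fun y => (g y)^-1); split; first exact: regular_inv.
by apply: filterS fE => y ->.
Qed.

Definition sub_kspace : kspace k := KSpace sub_regular_near sub_regular_germ
  sub_regular_cst sub_regular_add sub_regular_mul sub_regular_neq0
  sub_regular_inv.

End Subspace.

(* The product of varieties.  Its topology is finer than the product          *)
(* topology: the sets {(x, y) in U x V | h(x, y) <> 0}, for U and V open and  *)
(* h in O(U) (x) O(V), form a basis.  Functions are locally quotients of such *)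
(* h.                                                                         *)
Section Product.
Variables (k : fieldType) (X Y : kspace k).

Definition prod_point : Type := (X * Y)%type.
HB.instance Definition _ := Choice.copy prod_point (X * Y)%type.

Definition tensor (U : set X) (V : set Y) (h : prod_point -> k) :=
  exists (n : nat) (a : 'I_n -> X -> k) (b : 'I_n -> Y -> k),
    [/\ forall i x, U x -> regular_at x (a i),
        forall i y, V y -> regular_at y (b i) &
        forall p, h p = \sum_(i < n) a i p.1 * b i p.2].

Definition prod_open : set_system prod_point :=
  [set W | forall p, W p -> exists (U : set X) (V : set Y) h,
    [/\ [/\ open U, U p.1, open V & V p.2], tensor U V h, h p != 0 &
        forall q, U q.1 -> V q.2 -> h q != 0 -> W q]].

Lemma tensorS U V U' V' h : U' `<=` U -> V' `<=` V ->
  tensor U V h -> tensor U' V' h.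
Proof.
move=> UU VV [n [a [b [ra rb hE]]]]; exists n, a, b; split=> // i z.
  by move/UU/ra.
by move/VV/rb.
Qed.

Lemma tensor_fin U V (I : finType) (a : I -> X -> k) (b : I -> Y -> k)
    (h : prod_point -> k) :
  (forall i x, U x -> regular_at x (a i)) ->
  (forall i y, V y -> regular_at y (b i)) ->
  (forall p, h p = \sum_i a i p.1 * b i p.2) -> tensor U V h.
Proof.
move=> ra rb hE; exists #|I|, (a \o enum_val), (b \o enum_val).
split=> [i x|i y|p]; [exact: ra|exact: rb|].
by rewrite hE (big_enum_val (A := I) (fun i => a i p.1 * b i p.2)).
Qed.

Lemma tensor_cst U V c : tensor U V (fun=> c).
Proof.
apply: (@tensor_fin _ _ unit (fun=> fun=> c) (fun=> fun=> 1)).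
- by move=> *; exact: regular_cst.
- by move=> *; exact: regular_cst.
- by move=> p; rewrite big_const card_unit /= mulr1 addr0.
Qed.

Lemma tensorM U V g h : tensor U V g -> tensor U V h ->
  tensor U V (fun p => g p * h p).
Proof.
move=> [n [a [b [ra rb gE]]]] [m [c [d [rc rd hE]]]].
apply: (@tensor_fin _ _ ('I_n * 'I_m)%type
  (fun ij x => a ij.1 x * c ij.2 x) (fun ij y => b ij.1 y * d ij.2 y)).
- by move=> i x Ux; apply: regular_mul; [exact: ra|exact: rc].
- by move=> i x Ux; apply: regular_mul; [exact: rb|exact: rd].
move=> p; rewrite gE hE big_distrlr /= pair_big /=.
by apply: eq_bigr => i _; rewrite mulrACA.
Qed.

Lemma tensorD U V g h : tensor U V g -> tensor U V h ->
  tensor U V (fun p => g p + h p).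
Proof.
move=> [n [a [b [ra rb gE]]]] [m [c [d [rc rd hE]]]].
apply: (@tensor_fin _ _ ('I_n + 'I_m)%type
  (fun ij => match ij with inl i => a i | inr j => c j end)
  (fun ij => match ij with inl i => b i | inr j => d j end)).
- by move=> [i|i] x Ux; [exact: ra|exact: rc].
- by move=> [i|i] x Ux; [exact: rb|exact: rd].
by move=> p; rewrite gE hE big_sumType.
Qed.

Fact prod_openT : prod_open setT.
Proof.
move=> p _; exists setT, setT, (fun=> 1); split=> //.
- by split=> //; exact: openT.
- exact: tensor_cst.
- exact: oner_neq0.
Qed.

Fact prod_openI : setI_closed prod_open.
Proof.
move=> A B HA HB p [Ap Bp].
have [U [V [h [[oU Up oV Vp] th hp hA]]]] := HA _ Ap.
have [U' [V' [h' [[oU' Up' oV' Vp'] th' hp' hB]]]] := HB _ Bp.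
exists (U `&` U'), (V `&` V'), (fun p => h p * h' p); split.
- by split=> //; exact: openI.
- by apply: tensorM; [apply: tensorS th|apply: tensorS th'] => z [].
- exact: mulf_neq0.
- move=> q [Uq Uq'] [Vq Vq']; rewrite mulf_eq0 negb_or => /andP[hq hq'].
  by split; [exact: hA|exact: hB].
Qed.

Fact prod_open_bigU (I : Type) (f : I -> set prod_point) :
  (forall i, prod_open (f i)) -> prod_open (\bigcup_i f i).
Proof.
move=> Hf p [i _ fip]; have [U [V [h [UV th hp hf]]]] := Hf i _ fip.
by exists U, V, h; split=> // q Uq Vq hq; exists i => //; exact: hf.
Qed.

HB.instance Definition _ := isOpenTopological.Build prod_point
  prod_openT prod_openI prod_open_bigU.

Definition prod_regular_at (p : prod_point) (f : prod_point -> k) :=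
  exists (U : set X) (V : set Y) g h,
    [/\ [/\ open U, U p.1, open V & V p.2], tensor U V g, tensor U V h,
        h p != 0 & \forall q \near p, f q = g q / h q].

Lemma tensor_neq0 U V h (p : prod_point) : open U -> U p.1 -> open V -> V p.2 ->
  tensor U V h -> h p != 0 ->
  \forall q \near p, [/\ U q.1, V q.2 & h q != 0].
Proof.
move=> oU Up oV Vp th hp.
suff o : open [set q : prod_point | [/\ U q.1, V q.2 & h q != 0]].
  by apply: open_nbhs_nbhs; split.
by move=> q [Uq Vq hq]; exists U, V, h.
Qed.

Fact prod_regular_near p f : prod_regular_at p f ->
  \forall q \near p, prod_regular_at q f.
Proof.
move=> [U [V [g [h [[oU Up oV Vp] tg th hp /near_join fE]]]]].
have hn := tensor_neq0 oU Up oV Vp th hp.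
by apply: filterS2 hn fE => q [Uq Vq hq] fq; exists U, V, g, h.
Qed.

Fact prod_regular_germ p f f' : (\forall q \near p, f q = f' q) ->
  prod_regular_at p f -> prod_regular_at p f'.
Proof.
move=> ff [U [V [g [h [UV tg th hp fE]]]]]; exists U, V, g, h; split=> //.
by apply: filterS2 ff fE => q ->.
Qed.

Fact prod_regular_cst p c : prod_regular_at p (fun=> c).
Proof.
exists setT, setT, (fun=> c), (fun=> 1); split; try exact: tensor_cst.
- by split=> //; exact: openT.
- exact: oner_neq0.
- by near=> q; rewrite divr1.
Unshelve. all: by end_near. Qed.

Fact prod_regular_common p f f' : prod_regular_at p f -> prod_regular_at p f' ->
  exists (U : set X) (V : set Y) g h g' h',
    [/\ [/\ open U, U p.1, open V & V p.2], tensor U V g /\ tensor U V h,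
        tensor U V g' /\ tensor U V h', h p != 0 /\ h' p != 0 &
        \forall q \near p, [/\ h q != 0, h' q != 0,
          f q = g q / h q & f' q = g' q / h' q]].
Proof.
move=> [U [V [g [h [[oU Up oV Vp] tg th hp fE]]]]].
move=> [U' [V' [g' [h' [[oU' Up' oV' Vp'] tg' th' hp' fE']]]]].
exists (U `&` U'), (V `&` V'), g, h, g', h'; split=> //.
- by split=> //; exact: openI.
- by split; [apply: tensorS tg|apply: tensorS th] => z [].
- by split; [apply: tensorS tg'|apply: tensorS th'] => z [].
have hn := tensor_neq0 oU Up oV Vp th hp.
have hn' := tensor_neq0 oU' Up' oV' Vp' th' hp'.
near=> q; split; [| |by near: q|by near: q].
  by have [] : [/\ U q.1, V q.2 & h q != 0] by near: q.
by have [] : [/\ U' q.1, V' q.2 & h' q != 0] by near: q.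
Unshelve. all: by end_near. Qed.

Fact prod_regular_add p f f' : prod_regular_at p f -> prod_regular_at p f' ->
  prod_regular_at p (fun q => f q + f' q).
Proof.
move=> rf rf'; have [U [V [g [h [g' [h' [UV]]]]]]] := prod_regular_common rf rf'.
move=> [tg th] [tg' th'] [hp hp'] fE.
exists U, V, (fun q => g q * h' q + g' q * h q), (fun q => h q * h' q).
split=> //; [|exact: tensorM|exact: mulf_neq0|].
  by apply: tensorD; exact: tensorM.
by apply: filterS fE => q [? ? -> ->]; rewrite addf_div.
Qed.

Fact prod_regular_mul p f f' : prod_regular_at p f -> prod_regular_at p f' ->
  prod_regular_at p (fun q => f q * f' q).
Proof.
move=> rf rf'; have [U [V [g [h [g' [h' [UV]]]]]]] := prod_regular_common rf rf'.
move=> [tg th] [tg' th'] [hp hp'] fE.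
exists U, V, (fun q => g q * g' q), (fun q => h q * h' q).
split=> //; [exact: tensorM|exact: tensorM|exact: mulf_neq0|].
by apply: filterS fE => q [? ? -> ->]; rewrite mulf_div.
Qed.

Fact prod_regular_neq0 p f : prod_regular_at p f -> f p != 0 ->
  \forall q \near p, f q != 0.
Proof.
move=> [U [V [g [h [[oU Up oV Vp] tg th hp fE]]]]].
rewrite (nbhs_singleton fE) mulf_eq0 negb_or => /andP[gp _].
have hn := tensor_neq0 oU Up oV Vp th hp.
have gn := tensor_neq0 oU Up oV Vp tg gp.
near=> q; have -> : f q = g q / h q by near: q.
have [_ _ gq] : [/\ U q.1, V q.2 & g q != 0] by near: q.
have [_ _ hq] : [/\ U q.1, V q.2 & h q != 0] by near: q.
by rewrite mulf_neq0 ?invr_eq0.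
Unshelve. all: by end_near. Qed.

Fact prod_regular_inv p f : prod_regular_at p f -> f p != 0 ->
  prod_regular_at p (fun q => (f q)^-1).
Proof.
move=> [U [V [g [h [UV tg th hp fE]]]]].
rewrite (nbhs_singleton fE) mulf_eq0 negb_or => /andP[gp _].
exists U, V, h, g; split=> //.
by apply: filterS fE => q ->; rewrite invf_div.
Qed.

Definition prod_kspace : kspace k := KSpace prod_regular_near
  prod_regular_germ prod_regular_cst prod_regular_add prod_regular_mul
  prod_regular_neq0 prod_regular_inv.

End Product.

Section Varieties.
Variable k : fieldType.
Implicit Types X Y : kspace k.

Definition morphism_at X Y (f : X -> Y) (x : X) :=
  {for x, continuous f} /\
  forall g, regular_at (f x) g -> regular_at x (g \o f).

Definition morphism_on X Y (U : set X) (f : X -> Y) :=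
  forall x, U x -> morphism_at f x.

Definition kspace_iso X Y := exists (f : X -> Y) (g : Y -> X),
  [/\ cancel f g, cancel g f, morphism_on setT f & morphism_on setT g].

Definition is_affine X := exists (n : nat) (Z : set (affine_space k n)),
  closed Z /\ kspace_iso X (sub_kspace Z).

(* Varieties may be reducible. *)
Definition is_variety X :=
  (exists (m : nat) (U : 'I_m -> set X),
    (forall i, open (U i) /\ is_affine (sub_kspace (U i))) /\
    \bigcup_i U i = setT) /\
  closed [set p : prod_kspace X X | p.1 = p.2].

Definition irreducible (T : topologicalType) :=
  [set: T] !=set0 /\
  forall A B : set T, closed A -> closed B -> A `|` B = setT ->
    A = setT \/ B = setT.

Definition locally_closed (T : topologicalType) (A : set T) :=
  exists U F : set T, [/\ open U, closed F & A = U `&` F].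

Definition constructible (T : topologicalType) (A : set T) :=
  exists (n : nat) (L : 'I_n -> set T),
    (forall i, locally_closed (L i)) /\ A = \bigcup_i L i.

End Varieties.

Lemma open_denseI (T : topologicalType) (U V : set T) :
  open U -> dense U -> dense V -> dense (U `&` V).
Proof.
move=> oU dU dV O O0 oO; rewrite setIA.
by apply: dV; [exact: dU|exact: openI].
Qed.

(* Rational maps, as classes of morphisms defined on dense opens. *)
Section RationalMaps.
Variables (k : fieldType) (X Y : kspace k).

Record ratrep := RatRep {
  rdom : set X;
  rfun : X -> Y;
  rdom_open : open rdom;
  rdom_dense : dense rdom;
  rfun_morphism : morphism_on rdom rfun
}.

HB.instance Definition _ := gen_eqMixin ratrep.
HB.instance Definition _ := gen_choiceMixin ratrep.

Definition same_ratmap (r s : ratrep) := exists W : set X,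
  [/\ open W, dense W, W `<=` rdom r `&` rdom s &
      forall x, W x -> rfun r x = rfun s x].

Definition same_ratmapb (r s : ratrep) : bool := `[< same_ratmap r s >].

Fact same_ratmapb_refl : reflexive same_ratmapb.
Proof.
move=> r; apply/asboolP; exists (rdom r); split=> //.
- exact: rdom_open.
- exact: rdom_dense.
Qed.

Fact same_ratmapb_sym : symmetric same_ratmapb.
Proof.
have H r s : same_ratmapb r s -> same_ratmapb s r.
  move=> /asboolP[W [oW dW Wrs rs]]; apply/asboolP.
  by exists W; split=> [||x /Wrs[]|x /rs].
by move=> r s; apply/idP/idP; exact: H.
Qed.

Fact same_ratmapb_trans : transitive same_ratmapb.
Proof.
move=> s r t /asboolP[W [oW dW Wrs rs]] /asboolP[W' [oW' dW' Wst st]].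
apply/asboolP; exists (W `&` W'); split.
- exact: openI.
- exact: open_denseI.
- by move=> x [/Wrs[? _] /Wst[_ ?]].
- by move=> x [/rs -> /st].
Qed.

Canonical same_ratmap_equiv := EquivRel same_ratmapb
  same_ratmapb_refl same_ratmapb_sym same_ratmapb_trans.

Local Open Scope quotient_scope.

Definition ratmap : Type := {eq_quot same_ratmapb}.
HB.instance Definition _ := Choice.on ratmap.
HB.instance Definition _ := EqQuotient.on ratmap.

(* alpha is defined on U, where it is given by f *)
Definition represented_by (alpha : ratmap) (U : set X) (f : X -> Y) :=
  exists r : ratrep, [/\ \pi_ratmap r = alpha, rdom r = U &
    forall x, U x -> rfun r x = f x].

(* alpha restricts to an isomorphism between dense opens U and V *)
Definition birational (alpha : ratmap) :=
  exists (U : set X) (f : X -> Y) (V : set Y) (g : Y -> X),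
  [/\ represented_by alpha U f,
      [/\ open V, dense V & morphism_on V g],
      forall x, U x -> V (f x) /\ g (f x) = x &
      forall y, V y -> U (g y) /\ f (g y) = y].

End RationalMaps.

Definition is_rational (k : fieldType) (X : kspace k) :=
  exists (n : nat) (alpha : ratmap X (affine_space k n)), birational alpha.

Section Bir.
Variable k : fieldType.

Definition Bir (X : kspace k) : Type := {alpha : ratmap X X | birational alpha}.
HB.instance Definition _ X := gen_eqMixin (Bir X).
HB.instance Definition _ X := gen_choiceMixin (Bir X).

(* {x | (t, x) in U}, i.e. U_t under the identification of {t} x X with X *)
Definition fiber (T X : kspace k) (U : set (prod_kspace T X)) (t : T) : set X :=
  [set x | U (t, x)].

Definition pseudo_automorphism_on (T X : kspace k)
    (phi : Bir (prod_kspace T X)) (U : set (prod_kspace T X))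
    (f : prod_kspace T X -> X) :=
  [/\ open U /\ dense U,
      forall t, dense (fiber U t),
      morphism_on U f,
      represented_by (sval phi) U (fun p => (p.1, f p)) &
      forall t, exists beta : Bir X,
        represented_by (sval beta) (fiber U t) (fun x => f (t, x))].

Definition pseudo_automorphism (T X : kspace k) (phi : Bir (prod_kspace T X)) :=
  exists U f, pseudo_automorphism_on phi U f.

Definition bir_morphism (T X : kspace k) (F : T -> Bir X) :=
  exists (phi : Bir (prod_kspace T X)) U f, pseudo_automorphism_on phi U f /\
    forall t, represented_by (sval (F t)) (fiber U t) (fun x => f (t, x)).

Definition bir_closed (X : kspace k) (F : set (Bir X)) :=
  forall T : kspace k, is_variety T ->
  forall phi : T -> Bir X, bir_morphism phi -> closed (phi @^-1` F).

Definition bir_open (X : kspace k) : set_system (Bir X) :=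
  [set W | bir_closed (~` W)].

Fact bir_openT X : bir_open (X := X) setT.
Proof. by move=> T vT phi mphi; rewrite setCT preimage_set0; exact: closed0. Qed.

Fact bir_openI X : setI_closed (bir_open (X := X)).
Proof.
move=> A B oA oB T vT phi mphi.
rewrite setCI preimage_setU; apply: closedU; [exact: oA|exact: oB].
Qed.

Fact bir_open_bigU X (I : Type) (W : I -> set (Bir X)) :
  (forall i, bir_open (W i)) -> bir_open (\bigcup_i W i).
Proof.
move=> oW T vT phi mphi; rewrite setC_bigcup preimage_bigcap.
by apply: closed_bigI => i _; exact: oW.
Qed.

HB.instance Definition _ X := isOpenTopological.Build (Bir X)
  (@bir_openT X) (@bir_openI X) (@bir_open_bigU X).

Lemma bir_closedP X (F : set (Bir X)) : closed F <-> bir_closed F.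
Proof.
rewrite -openC; change (open (~` F)) with (bir_closed (~` ~` F)).
by rewrite setCK.
Qed.

End Bir.

(* Main.v *)
Require Import Defs.
From mathcomp Require Import all_boot all_order all_algebra.
From mathcomp Require Import all_classical topology.
From mathcomp Require mpoly closed_field.
Import (canonicals, coercions) mpoly.

(* Fix a chart [Y] of [X] with coordinates [y_l].  Every [y_l \o phi_t] is a
   quotient of two functions taken from one finite-dimensional space of rational
   functions on [X], with a denominator common to all [l]; this uses that [T] is
   quasi-compact.  Writing these quotients in a basis of row vectors [gam_c],
   c < K, a birational map [g] has a space of relations
     W(g) = {u | sum_c u_c gam_c(x)_l = y_l(g x) * sum_c u_c gam_c(x)_None},
   and by linear independence any nonzero element of W(g) determines [g].  Let j
   be minimal such that W(g) contains a nonzero vector supported on 0..j; it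
   contains exactly one such vector (u, 1), and on the stratum of [g] with given
   j the map g |-> u is injective.  For a family [g_s], minors of the linear
   system and Cramer's rule show that j is semicontinuous and that u depends
   regularly on s, so preimages under g |-> u of constructible subsets of k^j are
   constructible in Bir(X).  The set of u coming from some [phi_t], t in C, is
   first-order definable, hence constructible by quantifier elimination. *)

Set Implicit Arguments.
Unset Strict Implicit.
Unset Printing Implicit Defensive.

Import Order.TTheory GRing.Theory.
Local Open Scope classical_set_scope.
Local Open Scope ring_scope.

(** * Constructible sets *)

Section Constructible.
Variable T : topologicalType.
Implicit Types A B U F : set T.

Lemma constructible_fin (I : finType) (L : I -> set T) :
  (forall i, locally_closed (L i)) -> constructible (\bigcup_i L i).
Proof.
move=> lcL; exists #|I|, (L \o enum_val); split=> [i|]; first exact: lcL.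
apply/seteqP; split=> [x [i _ Lix]|x [i _ Lix]]; last by exists (enum_val i).
by exists (enum_rank i) => //=; rewrite enum_rankK.
Qed.

Lemma constructible_lc A : locally_closed A -> constructible A.
Proof.
move=> lcA; have -> : A = \bigcup_(_ : unit) A.
  by apply/seteqP; split=> [x Ax|x [_ _ //]]; exists tt.
exact: constructible_fin.
Qed.

Lemma constructible_open U : open U -> constructible U.
Proof. by move=> oU; apply: constructible_lc; exists U, setT; rewrite setIT; split. Qed.

Lemma constructible_closed F : closed F -> constructible F.
Proof.
by move=> cF; apply: constructible_lc; exists setT, F; rewrite setTI; split=> //; exact: openT.
Qed.

Lemma constructibleU A B : constructible A -> constructible B ->
  constructible (A `|` B).
Proof.
move=> [n [L [lcL ->]]] [m [M [lcM ->]]].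
have -> : \bigcup_i L i `|` \bigcup_i M i =
    \bigcup_i (match i : 'I_n + 'I_m with inl i => L i | inr i => M i end).
  apply/seteqP; split=> [x [[i _ h]|[i _ h]]|x [[i|i] _ h]].
  - by exists (inl i).
  - by exists (inr i).
  - by left; exists i.
  - by right; exists i.
by apply: constructible_fin => -[].
Qed.

Lemma constructibleI A B : constructible A -> constructible B ->
  constructible (A `&` B).
Proof.
move=> [n [L [lcL ->]]] [m [M [lcM ->]]].
have -> : \bigcup_i L i `&` \bigcup_i M i =
    \bigcup_(ij : 'I_n * 'I_m) (L ij.1 `&` M ij.2).
  apply/seteqP; split=> [x [[i _ h] [j _ h']]|x [[i j] _ [h h']]].
  - by exists (i, j).
  - by split; [exists i|exists j].
apply: constructible_fin => -[i j] /=.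
have [U [F [oU cF ->]]] := lcL i; have [U' [F' [oU' cF' ->]]] := lcM j.
by exists (U `&` U'), (F `&` F'); rewrite setIACA; split; [exact: openI|exact: closedI|].
Qed.

Lemma constructible0 : constructible (set0 : set T).
Proof. exact/constructible_open/open0. Qed.

Lemma constructible_bigcup n (A : nat -> set T) :
  (forall i, (i < n)%N -> constructible (A i)) ->
  constructible (\bigcup_(i < n) A i).
Proof.
elim: n => [|n IHn] cA; first by rewrite II0 bigcup_set0; exact: constructible0.
rewrite bigcup_mkord big_ord_recr /= -bigcup_mkord; apply: constructibleU.
  by apply: IHn => i /ltnW; apply: cA.
exact: cA.
Qed.

Lemma constructibleC A : constructible A -> constructible (~` A).
Proof.
move=> [n [L [lcL ->]]]; elim: n => [|n IHn] in L lcL *.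
  have -> : ~` (\bigcup_i L i) = setT by apply/seteqP; split=> // x _ [[]].
  exact/constructible_open/openT.
have -> : ~` (\bigcup_i L i) =
    ~` L ord0 `&` ~` (\bigcup_(i : 'I_n) L (lift ord0 i)).
  rewrite -setCU; congr (~` _); apply/seteqP; split=> [x [i _]|x [h|[i _ h]]].
  - by have [j ->|->] := unliftP ord0 i; [right; exists j|left].
  - by exists ord0.
  - by exists (lift ord0 i).
apply: constructibleI; last exact: IHn.
have [U [F [oU cF ->]]] := lcL ord0; rewrite setCI; apply: constructibleU.
  exact/constructible_closed/open_closedC.
exact/constructible_open/closed_openC.
Qed.

(* The boundary [closure (L i) `\` U i] of each piece [L i = U i `&` F i] is
   nowhere dense in the closure of the union, so removing all boundaries
   leaves a dense open set. *)
Lemma constructible_dense_open A : constructible A -> exists V : set T,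
  [/\ V `<=` A, exists2 O : set T, open O & V = O `&` closure A &
      closure A `<=` closure V].
Proof.
move=> [n [L [lcL AE]]].
pose UF i := projT1 (cid (lcL i)).
have [oU LU] : (forall i, open (UF i)) /\
    forall i, L i = UF i `&` closure (L i).
  split=> i; rewrite /UF; case: cid => U /= [F [oU cF LE]] //.
  apply/seteqP; split=> [x Lx|x [Ux clx]].
    by split; [move: Lx; rewrite LE => -[]|exact: subset_closure].
  rewrite LE; split=> //; rewrite ((closure_id F).1 cF).
  by apply: closure_subset clx; rewrite LE; exact: subIsetr.
pose D i := closure (L i) `&` ~` UF i.
have cD i : closed (D i).
  by apply: closedI; [exact: closed_closure|exact: open_closedC].
have step (s : seq 'I_n) B : open B -> (B `&` A) !=set0 ->
    exists B', [/\ B' `<=` B, open B', (B' `&` A) !=set0 &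
      forall i x, i \in s -> B' x -> ~ D i x].
  elim: s B => [|i s IHs] B oB BA; first by exists B; split.
  have [B1 [B1B oB1 B1A B1i]] : exists B1, [/\ B1 `<=` B, open B1,
      (B1 `&` A) !=set0 & forall x, B1 x -> ~ D i x].
    (* If [B] meets [D i] at [x], then [x] is in the closure of [L i], so [B] meets [L i]; cutting
       [B] with [UF i] keeps that meeting point and leaves [D i]. *)
    have [h|/existsNP[x /not_implyP[Bx /contrapT[clx _]]]] :=
        pselect (forall x, B x -> ~ D i x); first by exists B; split.
    have [y [Ly By]] := clx _ (open_nbhs_nbhs (conj oB Bx)).
    exists (B `&` UF i); split; [exact: subIsetl|exact: openI (oU i)| |].
      exists y; split; last by rewrite AE; exists i.
      by split=> //; move: Ly; rewrite LU => -[].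
    by move=> z [_ ?] [].
  have [B' [B'B1 oB' B'A B's]] := IHs _ oB1 B1A.
  exists B'; split=> // [x /B'B1/B1B//|j x].
  rewrite in_cons => /predU1P[-> B'x|js]; last exact: B's.
  exact/B1i/B'B1.
exists (~` (\bigcup_i D i) `&` closure A); split.
- move=> x [Ox clx].
  have clA : closure A `<=` \bigcup_i closure (L i).
    have /closure_id -> : closed (\bigcup_i closure (L i)).
      by apply: closed_bigcup => [|i _]; [exact: finite_finset|exact: closed_closure].
    by apply: closure_subset; rewrite AE => y [i _ Ly]; exists i => //; exact: subset_closure.
  have [i _ cli] := clA _ clx; rewrite AE; exists i => //.
  rewrite LU; split=> //; apply: contrapT => nUx.
  by apply: Ox; exists i.
- exists (~` (\bigcup_i D i)) => //; apply: closed_openC.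
  by apply: closed_bigcup => //; exact: finite_finset.
move=> x clx B; rewrite nbhsE => -[B0 [oB0 B0x] B0B].
have [y [Ay By]] := clx _ (open_nbhs_nbhs (conj oB0 B0x)).
have BA : (B0 `&` A) !=set0 by exists y.
have [B' [B'B oB' [z [B'z Az]] B'i]] := step (enum 'I_n) _ oB0 BA.
exists z; split; last exact/B0B/B'B.
split; last exact: subset_closure.
by move=> [i _ Di]; apply: (B'i i z) => //; rewrite mem_enum.
Qed.

End Constructible.

(** * Noetherianity of affine space *)

Section Noetherian.

(** Each index is chosen beyond the previous one so as to minimise [f] on that whole tail; every
    later index lies in the same tail. *)
Lemma nondecreasing_subsequence (f : nat -> nat) : exists sigma : nat -> nat,
  (forall i j, (i < j)%N -> (sigma i < sigma j)%N) /\
  (forall i j, (i <= j)%N -> (f (sigma i) <= f (sigma j))%N).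
Proof.
have next N : {m | (N < m)%N /\ forall m', (N < m')%N -> (f m <= f m')%N}.
  apply: cid.
  pose P v := `[< exists2 m, (N < m)%N & f m = v >].
  have exP : exists v, P v by exists (f N.+1); apply/asboolP; exists N.+1.
  have [v /asboolP[m Nm <-] vmin] := ex_minnP exP.
  by exists m; split=> // m' Nm'; apply: vmin; apply/asboolP; exists m'.
pose sigma := fix s i := if i is j.+1 then sval (next (s j)) else sval (next 0).
have sS i : (sigma i < sigma i.+1)%N by rewrite /=; case: (next _) => m [].
exists sigma; split; first exact: (homo_ltn ltn_trans).
apply: (@homo_leq _ (f \o sigma) leq leqnn leq_trans) => i.
have [N sE] : exists N, sigma i = sval (next N).
  by case: i => [|i]; [exists 0|exists (sigma i)].
have := sS i; rewrite /comp sE; case: (next N) => m [/= Nm mmin] mS.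
exact/mmin/(ltn_trans Nm).
Qed.

(** Dickson's lemma for exponent vectors: refine the subsequence once for each coordinate in [r]. *)
Lemma dickson (I : eqType) (r : seq I) (f : nat -> I -> nat) :
  exists sigma : nat -> nat,
  (forall i j, (i < j)%N -> (sigma i < sigma j)%N) /\
  (forall l i j, l \in r -> (i <= j)%N -> (f (sigma i) l <= f (sigma j) l)%N).
Proof.
elim: r => [|l r [s [s_lt s_le]]]; first by exists id.
have [s' [s'_lt s'_le]] := nondecreasing_subsequence (fun i => f (s i) l).
exists (s \o s'); split=> [i j /s'_lt/s_lt//|l' i j].
rewrite in_cons => /predU1P[->|l'r] ij; first exact: s'_le.
by apply: s_le => //; exact: (ltnW_homo s'_lt).
Qed.

Variables (k : fieldType) (n : nat).
Local Notation mpol := (mpoly.mpoly n k).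
Implicit Types p q : mpol.

(** One step of multivariate division: a monomial multiple of [q] cancels the leading term of
    [p]. *)
Lemma mlead_reduce p q : p != 0 -> q != 0 ->
  mpoly.lem (mpoly.mlead q) (mpoly.mlead p) ->
  exists a : mpol, p - a * q != 0 ->
    (mpoly.mlead (p - a * q) < mpoly.mlead p)%O.
Proof.
move=> p0 q0 qp; set m := mpoly.mnm_sub (mpoly.mlead p) (mpoly.mlead q).
pose c := mpoly.mcoeff (mpoly.mlead p) p / mpoly.mcoeff (mpoly.mlead q) q.
exists (c *: mpoly.mpolyX k m) => r0; rewrite -scalerAl in r0 *.
have leadX : mpoly.mnm_add (mpoly.mlead (mpoly.mpolyX k m)) (mpoly.mlead q) =
    mpoly.mlead p by rewrite mpoly.mleadXm mpoly.submK.
rewrite lt_neqAle; apply/andP; split.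
  (* If the leading monomial did not drop, its coefficient would be zero by the choice of [c],
     forcing the remainder to be zero. *)
  apply: contraNneq r0 => leadE; rewrite -mpoly.mleadc_eq0 leadE.
  rewrite mpoly.mcoeffB mpoly.mcoeffZ -{2}leadX mpoly.mleadcM.
  rewrite mpoly.mleadXm mpoly.mcoeffX eqxx mul1r divfK ?subrr//.
  by rewrite mpoly.mleadc_eq0.
apply: le_trans (mpoly.mleadB_le _ _) _; rewrite leUx lexx /=.
apply: le_trans (mpoly.mleadZ_le _ _) _.
by rewrite -leadX; exact: mpoly.mleadM_le.
Qed.

(* Successively choose [f i] in [I] of minimal leading monomial among those not
   vanishing on the zero locus of the previous ones.  By Dickson's lemma some
   leading monomial divides a later one; reducing contradicts minimality. *)
Lemma zero_locus_ideal (I : set mpol) :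
  (forall p q a, I p -> I q -> I (p - a * q)) ->
  exists s : seq mpol, (forall p, p \in s -> I p) /\
    zero_locus [set` s] `<=` zero_locus I.
Proof.
move=> idI; apply: contrapT => noS.
pose van (s : seq mpol) p :=
  forall x : affine_point k n, zero_locus [set` s] x -> peval p x = 0.
have next (s : seq mpol) : {p | (forall p, p \in s -> I p) ->
    [/\ I p, ~ van s p & forall q, I q -> ~ van s q ->
      ~ (mpoly.mlead q < mpoly.mlead p)%O]}.
  apply: cid; have [sI|] := pselect (forall p, p \in s -> I p); last by exists 0.
  apply: contrapT => nomin; apply: noS; exists s; split=> // x sx p Ip.
  suff : van s p by apply.
  (* Without a minimal choice, well-founded induction on leading monomials makes all of [I] vanish
     on the zero locus of [s]. *)
  elim/mpoly.mleadrect: p Ip => p IHp Ip; apply: contrapT => nvp.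
  by apply: nomin; exists p => _; split=> // q Iq nvq /IHp/(_ Iq).
pose l := fix l i := if i is j.+1 then sval (next (l j)) :: l j else [::].
pose f i := sval (next (l i)).
have lI i : forall p, p \in l i -> I p.
  elim: i => [//|i IHi] p; rewrite in_cons => /predU1P[->|/IHi//].
  by case: (next (l i)) => p' /= /(_ IHi)[].
have fP i : [/\ I (f i), ~ van (l i) (f i) & forall q, I q -> ~ van (l i) q ->
    ~ (mpoly.mlead q < mpoly.mlead (f i))%O].
  by rewrite /f; case: (next (l i)) => p' /= /(_ (lI i)).
have fl i j : (i < j)%N -> f i \in l j.
  elim: j => // j IHj; rewrite ltnS leq_eqVlt in_cons => /predU1P[->|/IHj->].
    by rewrite eqxx.
  by rewrite orbT.
have f0 i : f i != 0.
  by have [_ /[swap] _] := fP i; apply: contra_notN => /eqP-> x _; exact: rmorph0.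
have [s [s_lt s_le]] := dickson (enum 'I_n) (fun i m => mpoly.mlead (f i) m).
have s01 := s_lt _ _ (ltnSn 0).
have [Ip nvp pmin] := fP (s 1); have [Iq _ _] := fP (s 0).
have [|a aP] := @mlead_reduce (f (s 1)) (f (s 0)) (f0 _) (f0 _).
  by apply/mpoly.mnm_lepP => i; apply: s_le; rewrite ?mem_enum.
(* [f (s 0)] is one of the equations [l (s 1)], so the reduction keeps its values on their zero
   locus and still does not vanish identically there. *)
have vE x : zero_locus [set` l (s 1)] x ->
    peval (f (s 1) - a * f (s 0)) x = peval (f (s 1)) x.
  by move=> lx; rewrite /peval rmorphB rmorphM /= -/(peval (f (s 0)) x)
    (lx _ (fl _ _ s01)) mulr0 subr0.
have nvr : ~ van (l (s 1)) (f (s 1) - a * f (s 0)).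
  by move=> vr; apply: nvp => x lx; rewrite -(vE _ lx); exact: vr.
apply: pmin (nvr) (aP _); first exact: idI.
by apply: contra_notN nvr => /eqP -> x _; exact: rmorph0.
Qed.

(** Apply the previous lemma to the polynomials that vanish on the zero locus of some finite part of
    [S]; the finitely many members found involve only finitely many elements of [S]. *)
Lemma zero_locus_finite (S : set mpol) : exists s : seq mpol,
  (forall p, p \in s -> S p) /\ zero_locus [set` s] = zero_locus S.
Proof.
pose I := [set p | exists2 s : seq mpol, (forall p, p \in s -> S p) &
  forall x : affine_point k n, zero_locus [set` s] x -> peval p x = 0].
have [p q a [s sS sp] [t tS tq]|s [sI sZ]] := @zero_locus_ideal I.
  exists (s ++ t) => [r|x stx]; first by rewrite mem_cat => /orP[/sS|/tS].
  rewrite /peval rmorphB rmorphM /= -/(peval p x) -/(peval q x) sp ?tq ?mulr0 ?subrr//.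
    by move=> r rt; apply: stx; rewrite /= mem_cat rt orbT.
  by move=> r rs; apply: stx; rewrite /= mem_cat rs.
have [t [tS ts]] : exists t : seq mpol, (forall p, p \in t -> S p) /\
    zero_locus [set` t] `<=` zero_locus [set` s].
  elim: s sI {sZ} => [|p s IHs] sI; first by exists [::].
  have [q qs|t [tS ts]] := IHs; first by apply: sI; rewrite in_cons qs orbT.
  have [u uS up] := sI p (mem_head _ _).
  exists (t ++ u); split=> [q|x tux q].
    by rewrite mem_cat => /orP[/tS|/uS].
  rewrite /= in_cons => /predU1P[->|qs].
    by apply: up => r ru; apply: tux; rewrite /= mem_cat ru orbT.
  by apply: (ts x) => // r rt; apply: tux; rewrite /= mem_cat rt.
exists t; split=> //; apply/seteqP; split=> [x /ts/sZ xI p Sp|x Sx p /tS/Sx//].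
apply: xI; exists [:: p] => [q|y]; first by rewrite mem_seq1 => /eqP ->.
by apply; rewrite /= mem_seq1.
Qed.

End Noetherian.

(** * Linear independence of functions *)

Section LinearIndependence.
Variables (k : fieldType) (R : Type) (P : set R).
Implicit Types (E F : nat -> R -> k) (u : nat -> k).

(** Coefficients are sequences on [nat] of which only the first [j] entries count, so that [j] can
    vary without casts. *)
Definition indep E j := forall u,
  (forall r, P r -> \sum_(c < j) u c * E c r = 0) ->
  forall c, (c < j)%N -> u c = 0.

Lemma indep_leq E i j : (i <= j)%N -> indep E j -> indep E i.
Proof.
move=> ij indE u uE c ci.
have := indE (fun c => if (c < i)%N then u c else 0) _ c (leq_trans ci ij).
rewrite ci; apply=> r Pr; rewrite -[RHS](uE r Pr).
rewrite (big_ord_widen _ (fun c => u c * E c r) ij) [RHS]big_mkcond /=.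
by apply: eq_bigr => d _; case: ifP; rewrite ?mul0r.
Qed.

(** Induction on [j]: the points found so far determine the only candidate for a relation with last
    coefficient 1; a point where it fails completes the minor. *)
Lemma indep_minor E j : indep E j -> exists r : 'I_j -> R,
  (forall i, P (r i)) /\ \det (\matrix_(c < j, i < j) E c (r i)) != 0.
Proof.
elim: j => [|j IHj] indE.
  exists (fun i : 'I_0 => False_rect R (notF (ltn_ord i))).
  by split=> [[]//|]; rewrite det_mx00 oner_eq0.
have [r [Pr rdet]] := IHj (indep_leq (leqnSn j) indE).
set A := \matrix_(c, i) E c (r i) in rdet.
pose w : 'rV_j := - (\row_i E j (r i)) *m invmx A.
have Aunit : A \in unitmx by rewrite unitmxE unitfE.
have wA : w *m A = - \row_i E j (r i) by rewrite mulmxKV.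
(* The candidate relation [(w, 1)]: it vanishes at all the points [r i]. *)
pose u c := if insub c is Some i then w 0 i else 1.
have uS c : u (widen_ord (leqnSn j) c) = w 0 c.
  by rewrite /u /= insubT//= => h; congr (w _ _); exact: val_inj.
have uj : u j = 1 by rewrite /u insubF// ltnn.
have [r' Pr' r'E] : exists2 r', P r' & \sum_(c < j.+1) u c * E c r' != 0.
  apply: contrapT => nr'; have : u j = 0.
    apply: indE => // r' Pr'; apply: contrapT => /eqP ?; apply: nr'.
    by exists r'.
  by rewrite uj => /eqP; rewrite oner_eq0.
exists (fun i => if unlift ord_max i is Some i' then r i' else r').
split=> [i|]; first by case: unlift.
(* The old points make a kernel vector [v] a multiple of [(w, 1)]; the new point [r'] makes the
   factor zero. *)
apply/negP => /det0P[v v0 vA].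
have vr i : \sum_(c < j) v 0 (widen_ord (leqnSn j) c) * E c (r i) =
    - v 0 ord_max * E j (r i).
  have /rowP/(_ (lift ord_max i)) := vA; rewrite !mxE big_ord_recr /= !mxE liftK.
  move/eqP; rewrite addr_eq0 -mulNr => /eqP <-.
  by apply: eq_bigr => c _; rewrite !mxE liftK.
have vw c : v 0 (widen_ord (leqnSn j) c) = v 0 ord_max * w 0 c.
  pose v' : 'rV_j := \row_c v 0 (widen_ord (leqnSn j) c).
  suff : v' = v 0 ord_max *: w by move=> /rowP/(_ c); rewrite !mxE.
  apply: (can_inj (mulmxK Aunit)); rewrite -scalemxAl wA; apply/rowP => i.
  rewrite !mxE mulrN -mulNr -vr; apply: eq_bigr => d _; by rewrite !mxE.
have vm : v 0 ord_max = 0.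
  have /rowP/(_ ord_max) := vA; rewrite !mxE.
  under eq_bigr do rewrite mxE unlift_none.
  rewrite big_ord_recr /=; under eq_bigr do rewrite vw -mulrA.
  rewrite -mulr_sumr -mulrDr => /eqP; rewrite mulf_eq0 => /orP[/eqP//|].
  move: r'E; rewrite big_ord_recr /= uj mul1r.
  by under eq_bigr do rewrite uS; move=> /negPf ->.
move/eqP: v0; apply; apply/rowP => c; rewrite mxE.
have [i ->|->] := unliftP ord_max c; last by [].
have -> : lift ord_max i = widen_ord (leqnSn j) i.
  by apply/val_inj; rewrite /= -[RHS]lift_max.
by rewrite vw vm mul0r.
Qed.

Lemma indep_of_minor E j (r : 'I_j -> R) : (forall i, P (r i)) ->
  \det (\matrix_(c < j, i < j) E c (r i)) != 0 -> indep E j.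
Proof.
move=> Pr rdet u uE c cj.
have : (\row_(c < j) u c) *m (\matrix_(c < j, i < j) E c (r i)) = 0.
  apply/rowP => i; rewrite !mxE -[RHS](uE _ (Pr i)).
  by apply: eq_bigr => d _; rewrite !mxE.
move/eqP: rdet => rdet; have [/eqP//|nu] := boolP (\row_(c < j) u c == 0).
  by move=> /rowP/(_ (Ordinal cj)); rewrite !mxE.
by move=> uA; case: rdet; apply/eqP/det0P; exists (\row_(c < j) u c).
Qed.

(** Greedy extraction of a basis: the next function is kept only if it lies outside the span of
    those already kept. *)
Lemma exists_indep_span F N : exists K (s : nat -> nat),
  [/\ forall c, (c < K)%N -> (s c < N)%N, indep (F \o s) K &
    forall i, (i < N)%N -> exists u, forall r, P r ->
      F i r = \sum_(c < K) u c * F (s c) r].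
Proof.
elim: N => [|N [K [s [sN sind sspan]]]]; first by exists 0, id; split.
have [[u uF]|nspan] := pselect (exists u, forall r, P r ->
      F N r = \sum_(c < K) u c * F (s c) r).
  exists K, s; split=> // [c /sN/ltnW//|i].
  by rewrite ltnS leq_eqVlt => /predU1P[->|/sspan//]; exists u.
pose s' c := if (c < K)%N then s c else N.
have s'E c : (c < K)%N -> s' c = s c by rewrite /s' => ->.
have s'K : s' K = N by rewrite /s' ltnn.
exists K.+1, s'; split=> [c _|u uE|i].
- by rewrite /s'; case: ifP => // /sN/ltnW.
- have {}uE r : P r -> \sum_(c < K) u c * F (s c) r + u K * F N r = 0.
    move=> /uE; rewrite big_ord_recr /= s'K; apply: etrans; congr (_ + _).
    by apply: eq_bigr => c _; rewrite s'E.
  have uK : u K = 0.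
    apply/eqP; apply: contra_notT nspan => uK.
    exists (fun c => - (u c / u K)) => r /uE/eqP; rewrite addrC addr_eq0 => /eqP FE.
    apply: (mulfI uK); rewrite FE mulr_sumr -sumrN; apply: eq_bigr => c _.
    by rewrite mulNr mulrN mulrA mulrCA divff// mulr1.
  move=> c; rewrite ltnS leq_eqVlt => /predU1P[->//|]; apply: sind => r /uE.
  by rewrite uK mul0r addr0.
- rewrite ltnS leq_eqVlt => /predU1P[->|/sspan[u uF]].
    exists (fun c => (c == K)%:R) => r _; rewrite big_ord_recr /= s'K eqxx mul1r.
    by rewrite big1 ?add0r// => c _; rewrite ltn_eqF ?mul0r.
  exists (fun c => if (c < K)%N then u c else 0) => r /uF ->.
  rewrite big_ord_recr /= ltnn mul0r addr0; apply: eq_bigr => c _.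
  by rewrite ltn_ord s'E.
Qed.

End LinearIndependence.

(** * Regular functions and quantifier elimination *)

Section Regular.
Variables (k : fieldType) (X : kspace k) (x : X).

Lemma regular_sum (I : Type) (r : seq I) (P : pred I) (F : I -> X -> k) :
  (forall i, P i -> regular_at x (F i)) ->
  regular_at x (fun y => \sum_(i <- r | P i) F i y).
Proof.
move=> rF; elim: r => [|i r IHr].
  apply: (regular_germ _ (regular_cst x 0)).
  by near=> y; rewrite big_nil.
have [Pi|nPi] := boolP (P i); last first.
  by apply: (regular_germ _ IHr); near=> y; rewrite big_cons (negPf nPi).
apply: (regular_germ _ (regular_add (rF i Pi) IHr)).
by near=> y; rewrite big_cons Pi.
Unshelve. all: by end_near. Qed.

Lemma regular_prod (I : Type) (r : seq I) (P : pred I) (F : I -> X -> k) :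
  (forall i, P i -> regular_at x (F i)) ->
  regular_at x (fun y => \prod_(i <- r | P i) F i y).
Proof.
move=> rF; elim: r => [|i r IHr].
  apply: (regular_germ _ (regular_cst x 1)).
  by near=> y; rewrite big_nil.
have [Pi|nPi] := boolP (P i); last first.
  by apply: (regular_germ _ IHr); near=> y; rewrite big_cons (negPf nPi).
apply: (regular_germ _ (regular_mul (rF i Pi) IHr)).
by near=> y; rewrite big_cons Pi.
Unshelve. all: by end_near. Qed.

Lemma regular_opp (f : X -> k) : regular_at x f -> regular_at x (fun y => - f y).
Proof.
move=> rf; apply: (regular_germ _ (regular_mul (regular_cst x (-1)) rf)).
by near=> y; rewrite mulN1r.
Unshelve. all: by end_near. Qed.

Lemma regular_det n (M : X -> 'M[k]_n) :
  (forall i j, regular_at x (fun y => M y i j)) ->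
  regular_at x (fun y => \det (M y)).
Proof.
move=> rM; apply: regular_sum => s _; apply: regular_mul; first exact: regular_cst.
by apply: regular_prod => i _; exact: rM.
Qed.

Lemma regular_adj n (M : X -> 'M[k]_n) i j :
  (forall i j, regular_at x (fun y => M y i j)) ->
  regular_at x (fun y => (\adj (M y)) i j).
Proof.
move=> rM; have rC : regular_at x (fun y => cofactor (M y) j i).
  apply: regular_mul; first exact: regular_cst.
  apply: regular_det => a b.
  by apply: (regular_germ _ (rM (lift j a) (lift i b))); near=> y; rewrite !mxE.
by apply: (regular_germ _ rC); near=> y; rewrite mxE.
Unshelve. all: by end_near. Qed.

(** Terms satisfying [rterm] contain no inverse, so no denominator has to be controlled. *)
Lemma regular_eval (e : X -> seq k) (t : GRing.term k) : GRing.rterm t ->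
  (forall i, regular_at x (fun y => (e y)`_i)) ->
  regular_at x (fun y => GRing.eval (e y) t).
Proof.
move=> + re; elim: t => //=.
- by move=> c _; exact: regular_cst.
- by move=> n _; exact: regular_cst.
- by move=> t1 IH1 t2 IH2 /andP[/IH1 ? /IH2 ?]; exact: regular_add.
- by move=> t IH /IH ?; exact: regular_opp.
- move=> t IH n /IH rt.
  apply: (regular_germ _ (regular_mul rt (regular_cst x n%:R))).
  by near=> y; rewrite mulr_natr.
- by move=> t1 IH1 t2 IH2 /andP[/IH1 ? /IH2 ?]; exact: regular_mul.
- move=> t IH n /IH rt.
  apply: (regular_germ _ (@regular_prod _ (index_iota 0 n) predT (fun=> _) (fun _ _ => rt))).
  by near=> y; rewrite prodr_const_nat subn0.
Unshelve. all: by end_near. Qed.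

End Regular.

(** * Definable predicates over an algebraically closed field *)

Section Definable.
Variable k : closedFieldType.
Implicit Types P Q : (nat -> k) -> Prop.

(** Assignments are lists padded with zeros, hence finitely supported sequences; formulas may use
    constants of [k]. *)
Definition definable P := exists2 f : GRing.formula k, GRing.rformula f &
  forall e : seq k, GRing.holds e f <-> P (nth 0 e).

Lemma definable_ext P Q : (forall e : seq k, P (nth 0 e) <-> Q (nth 0 e)) ->
  definable P -> definable Q.
Proof.
by move=> PQ [f rf fP]; exists f => // e; split=> [/fP/PQ//|/PQ/fP].
Qed.

Lemma definable_and P Q : definable P -> definable Q ->
  definable (fun a => P a /\ Q a).
Proof.
move=> [f rf fP] [g rg gQ]; exists (GRing.And f g) => [|e] /=; first by rewrite rf.
by split=> -[/fP ? /gQ ?].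
Qed.

Lemma definable_or P Q : definable P -> definable Q ->
  definable (fun a => P a \/ Q a).
Proof.
move=> [f rf fP] [g rg gQ]; exists (GRing.Or f g) => [|e] /=; first by rewrite rf.
by split=> -[/fP|/gQ]; tauto.
Qed.

Lemma definable_not P : definable P -> definable (fun a => ~ P a).
Proof.
move=> [f rf fP]; exists (GRing.Not f) => //= e.
by split=> h /fP.
Qed.

Lemma definable_bool (b : bool) : definable (fun=> b).
Proof. by exists (GRing.Bool b). Qed.

(** The variables in [I] are quantified: [e] may differ from [a] only there. *)
Lemma definable_exists P (I : seq nat) : definable P ->
  definable (fun a => exists2 e : seq k,
    (forall i, i \notin I -> a i = e`_i) & P (nth 0 e)).
Proof.
move=> [f rf fP]; exists (foldr GRing.Exists f I); first by elim: I.
by move=> e; split=> [/GRing.foldExistsP[e' ee' /fP]|[e' ee' /fP he']];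
  [exists e'|apply/GRing.foldExistsP; exists e'].
Qed.

Lemma poly_term n (p : mpoly.mpoly n k) (rho : 'I_n -> nat) :
  exists2 t : GRing.term k, GRing.rterm t &
    forall e, GRing.eval e t = peval p (\row_i e`_(rho i)).
Proof.
elim/mpoly.mpolyind: p => [|c m p _ _ [t rt tp]].
  by exists (GRing.Const 0) => // e; rewrite /peval rmorph0.
have [t' rt' t'm] : exists2 t : GRing.term k, GRing.rterm t &
    forall e, GRing.eval e t = \prod_(i < n) e`_(rho i) ^+ m i.
  elim: (index_enum 'I_n) => [|i r [t' rt' t'r]].
    by exists (GRing.Const 1) => // e; rewrite big_nil.
  exists (GRing.Mul (GRing.Exp (GRing.Var k (rho i)) (m i)) t') => // e /=.
  by rewrite big_cons t'r.
exists (GRing.Add (GRing.Mul (GRing.Const c) t') t) => [|e] /=; first by rewrite rt' rt.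
rewrite tp t'm /peval mpoly.mevalD mpoly.mevalZ mpoly.mevalX.
by congr (_ * _ + _); apply: eq_bigr => i _; rewrite mxE.
Qed.

(** Noetherianity replaces [S] by a finite list, whose equations form one conjunction. *)
Lemma definable_zero_locus n (S : set (mpoly.mpoly n k)) (rho : 'I_n -> nat) :
  definable (fun a => zero_locus S (\row_i a (rho i))).
Proof.
have [s [_ <-]] := zero_locus_finite S.
elim: s => [|p s IHs].
  by apply: definable_ext (definable_bool true) => e; split.
have [t rt tp] := poly_term p rho.
have defp : definable (fun a => peval p (\row_i a (rho i)) = 0).
  exists (GRing.Equal t (GRing.Const 0)) => [|e] /=; first by rewrite rt.
  by rewrite tp.
apply: definable_ext (definable_and defp IHs).
move=> e /=; split=> [[p0 s0] q|ps]; last first.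
  by split=> [|q qs]; apply: ps; rewrite /= in_cons ?eqxx// qs orbT.
by rewrite /= in_cons => /predU1P[->|/s0].
Qed.

Lemma definable_qf P : definable P -> exists f : GRing.formula k,
  [/\ GRing.qf_form f, GRing.rformula f &
      forall e, GRing.qf_eval e f <-> P (nth 0 e)].
Proof.
pose proj := @closed_field.ClosedFieldQE.ex_elim k.
have wf_proj : GRing.wf_QE_proj proj := @closed_field.ClosedFieldQE.wf_ex_elim k.
have ok_proj : GRing.valid_QE_proj proj :=
  closed_field.ClosedFieldQE.holds_ex_elim (@GRing.solve_monicpoly k).
move=> [f rf fP]; have /andP[qf rqf] := GRing.quantifier_elim_wf wf_proj rf.
exists (GRing.quantifier_elim proj f); split=> // e.
have qeP := GRing.quantifier_elim_rformP wf_proj ok_proj e rf.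
by split=> [/qeP/fP|/fP/qeP].
Qed.

End Definable.

(** * Affine varieties *)

Section Embedding.
Variable k : fieldType.

(** A closed immersion into affine space. The last clause expresses a regular germ by a fraction
    valid on the whole principal open set where its denominator is nonzero. *)
Definition affine_embedding (T : kspace k) n (tau : T -> affine_point k n) :=
  [/\ injective tau,
      forall t i, regular_at t (fun s => (tau s : 'rV[k]_n) 0 i),
      exists S, forall a, zero_locus S a <-> exists t, tau t = a,
      forall F : set T, closed F -> exists S, forall t, F t <-> zero_locus S (tau t) &
      forall t0 R, regular_at t0 R -> exists p q, peval q (tau t0) != 0 /\
        forall t, peval q (tau t) != 0 -> R t = peval p (tau t) / peval q (tau t)].

Lemma closed_near (T : topologicalType) n (tau : T -> affine_point k n) t0 (P : set T) :
  (forall F : set T, closed F -> exists S, forall t, F t <-> zero_locus S (tau t)) ->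
  (\forall t \near t0, P t) -> exists2 r, peval r (tau t0) != 0 &
    forall t, peval r (tau t) != 0 -> P t.
Proof.
move=> clE; rewrite {1}/prop_near1 nbhsE => -[B [oB Bt0] BP].
have [S BS] := clE _ (open_closedC oB).
have /existsNP[r /not_implyP[Sr /eqP r0]] : ~ zero_locus S (tau t0).
  by move=> /BS.
exists r => // t rt; apply: BP; apply: contrapT => /BS /(_ r Sr) rt0.
by rewrite rt0 eqxx in rt.
Qed.

Lemma is_affine_embedding (T : kspace k) : is_affine T ->
  exists n (tau : T -> affine_point k n), affine_embedding tau.
Proof.
move=> [n [Z [cZ [f [g [fK gK mf mg]]]]]].
pose tau t : affine_point k n := set_val (f t).
have fc : continuous f by move=> t; have [] := mf t I.
have gc : continuous g by move=> t; have [] := mg t I.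
have clE (F : set T) : closed F -> exists S, forall t, F t <-> zero_locus S (tau t).
  move=> cF.
  have := (continuous_closedP g).1 gc F cF.
  rewrite -openC => -[A [S AE] AF].
  exists S => t; rewrite -(fK t) -[F _]/((g @^-1` F) (f t)) -[g @^-1` F]setCK -AF AE.
  by rewrite /= fK; split=> [/contrapT|St]; [exact|].
exists n, tau; split=> //.
- by move=> s t /val_inj/(can_inj fK).
- move=> t i; have [_ h] := mf t I.
  apply: (h (fun y : sub_kspace Z => (set_val y : 'rV[k]_n) 0 i)).
  exists (fun a : affine_point k n => (a : 'rV[k]_n) 0 i); split; last by near=> y.
  exists (mpoly.mpolyX k (mpoly.mnm1 i)), 1; rewrite peval1 oner_eq0; split=> //.
  by near=> y; rewrite peval1 divr1 /peval mpoly.mevalXU.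
- have [S ZS] : exists S, Z = zero_locus S.
    by move: cZ; rewrite -openC => -[S /(congr1 setC)]; rewrite !setCK => ->; exists S.
  exists S => a; rewrite -ZS; split=> [Za|[t <-]]; last exact: set_valP.
  by exists (g (exist _ a (mem_set Za))); rewrite /tau gK.
- move=> t0 R rR; have [_] := mg (f t0) I; rewrite fK => /(_ R rR).
  move=> [G [[p [q [q0 GE]]] RE]].
  have near_t0 : \forall t \near t0, R t = peval p (tau t) / peval q (tau t).
    have h : \forall y \near f t0, (R \o g) y = peval p (set_val y) / peval q (set_val y).
      have GE' := @near_set_val k (affine_space k n) Z (f t0)
        (fun y => G y = peval p y / peval q y) GE.
      near=> y.
      have -> : (R \o g) y = G (set_val y) by near: y.
      by near: y.
    have h' : \forall t \near t0, R (g (f t)) = peval p (tau t) / peval q (tau t).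
      exact: (fc t0 _ h).
    by apply: filterS h' => t; rewrite fK.
  have [r r0 rE] := closed_near clE near_t0.
  (* The factor [r] shrinks the principal open set to where the fraction represents [R]. *)
  exists (p * r), (q * r); rewrite pevalM mulf_neq0//; split=> // t.
  rewrite !pevalM mulf_eq0 negb_or => /andP[qt rt].
  by rewrite rE// -mulf_div divff// mulr1.
Unshelve. all: by end_near. Qed.

(** The equations of [T], together with all [r] whose nonvanishing locus lies in some [O t], have no
    common zero; by Noetherianity finitely many of them already have none. *)
Lemma affine_quasi_compact (T : kspace k) (O : T -> set T) : is_affine T ->
  (forall t, \forall s \near t, O t s) ->
  exists l : seq T, forall s, exists2 t, t \in l & O t s.
Proof.
move=> /is_affine_embedding[n [tau [_ _ [Z ZE] clE _]]] Onear.
pose S := Z `|` [set r | exists t, forall s, peval r (tau s) != 0 -> O t s].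
have S0 a : ~ zero_locus S a.
  move=> Sa; have /ZE[t ta] : zero_locus Z a by move=> p Zp; apply: Sa; left.
  have [r r0 rO] := closed_near clE (Onear t).
  have : peval r a = 0 by apply: Sa; right; exists t.
  by rewrite -ta => /eqP; exact/negP.
have [l [lS lE]] := zero_locus_finite S.
have [l' l'E] : exists l' : seq T, forall r s, r \in l -> peval r (tau s) != 0 ->
    exists2 t, t \in l' & O t s.
  elim: l lS {lE} => [|r l IHl] lS; first by exists [::].
  have [p pl|l' l'E] := IHl; first by apply: lS; rewrite in_cons pl orbT.
  have [Zr|[t tO]] := lS r (mem_head _ _).
    exists l' => p s; rewrite in_cons => /predU1P[->|/l'E]; last exact.
    by rewrite ((ZE (tau s)).2 (ex_intro _ s erefl) r Zr) eqxx.
  exists (t :: l') => p s; rewrite in_cons => /predU1P[-> /tO Ots|/l'E pl' /pl'[t' t'l Ot']].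
    by exists t => //; exact: mem_head.
  by exists t' => //; rewrite in_cons t'l orbT.
exists l' => s; apply: contrapT => ns; apply: (S0 (tau s)).
rewrite -lE => r rl; apply: contrapT => /eqP rs; apply: ns; exact: l'E rl rs.
Qed.

End Embedding.

(** * Algebraic families of linear systems *)

(** A relation whose coefficient at [j] is nonzero, rescaled so that this coefficient is 1. *)
Definition ext (k : nzRingType) (u : nat -> k) j c := if (c < j)%N then u c else 1.

Lemma ext_sum (k : nzRingType) (u F : nat -> k) j :
  \sum_(c < j.+1) ext u j c * F c = \sum_(c < j) u c * F c + F j.
Proof.
rewrite big_ord_recr /= {2}/ext ltnn mul1r; congr (_ + _).
by apply: eq_bigr => c _; rewrite /ext ltn_ord.
Qed.

Section LinearSystems.
Variables (k : fieldType) (S : kspace k) (R : Type).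
Variables (P : S -> set R) (E : S -> nat -> R -> k).
Hypothesis P_near : forall s0 r, P s0 r -> \forall s \near s0, P s r.
Hypothesis E_regular : forall s0 r c, P s0 r -> regular_at s0 (fun s => E s c r).

Definition relation (s : S) j (u : nat -> k) :=
  forall r, P s r -> \sum_(c < j) u c * E s c r = 0.

Lemma minor_near s0 j (r : 'I_j -> R) : (forall i, P s0 (r i)) ->
  \det (\matrix_(c < j, i < j) E s0 c (r i)) != 0 ->
  \forall s \near s0, (forall i, P s (r i)) /\
    \det (\matrix_(c < j, i < j) E s c (r i)) != 0.
Proof.
move=> Pr rdet.
have Pn : \forall s \near s0, forall i, P s (r i).
  by apply: filter_forall => i; exact: P_near.
have rn : regular_at s0 (fun s => \det (\matrix_(c < j, i < j) E s c (r i))).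
  apply: regular_det => c i.
  by apply: (regular_germ _ (E_regular c (Pr i))); near=> s; rewrite mxE.
have dn := regular_neq0 rn rdet.
by near=> s; split; near: s.
Unshelve. all: by end_near. Qed.

(* On the locus where columns 0..j-1 are independent the solution [u] is unique
   and given near each point by Cramer's rule on a fixed choice of rows. *)
Lemma solution_closed j (t : GRing.term k) : GRing.rterm t ->
  closed [set s | ~ indep (P s) (E s) j \/ exists u,
    relation s j.+1 (ext u j) /\ GRing.eval (mkseq u j) t = 0].
Proof.
move=> rt; rewrite -openC openE => s0 /= /not_orP[/contrapT ind0 sol0].
have [r [Pr rdet]] := indep_minor ind0.
have rnear := minor_near Pr rdet.
(* If [s0] has a normalised solution, nearby ones are compared with Cramer's formula; otherwise the
   first [j.+1] functions are independent at [s0], hence nearby, and no solution exists there. *)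
have [[u0 u0s]|nosol] := pselect (exists u, relation s0 j.+1 (ext u j)).
  pose A s := \matrix_(c < j, i < j) E s c (r i).
  (* Cramer's rule at the points [r]. It makes sense even where the full system has no solution, and
     any solution near [s0] must equal it. *)
  pose w s : 'rV_j := (\det (A s))^-1 *: ((\row_i - E s j (r i)) *m \adj (A s)).
  pose wn s c := if insub c is Some i then w s 0 i else 0.
  have wE s u : (forall i, P s (r i)) -> \det (A s) != 0 ->
      relation s j.+1 (ext u j) -> mkseq u j = mkseq (wn s) j.
    move=> Ps ds us; apply: (eq_from_nth (x0 := 0)); first by rewrite !size_mkseq.
    move=> c; rewrite size_mkseq => cj; rewrite !nth_mkseq// /wn insubT.
    suff /rowP/(_ (Ordinal cj)) : \row_(c < j) u c = w s by rewrite mxE.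
    have uA : (\row_(c < j) u c) *m A s = \row_i - E s j (r i).
      apply/rowP => i; rewrite !mxE; apply/eqP; rewrite -addr_eq0; apply/eqP.
      rewrite -[RHS](us _ (Ps i)) (ext_sum _ (fun c => E s c (r i))); congr (_ + _).
      by apply: eq_bigr => d _; rewrite !mxE.
    rewrite /w -uA -mulmxA mul_mx_adj mul_mx_scalar scalerA mulVf// scale1r//.
  have wreg : regular_at s0 (fun s => GRing.eval (mkseq (wn s) j) t).
    apply: regular_eval rt _ => c.
    have [cj|cj] := ltnP c j; last first.
      apply: (regular_germ _ (regular_cst s0 0)).
      by near=> s; rewrite nth_default// size_mkseq.
    have rA a b : regular_at s0 (fun s => A s a b).
      by apply: (regular_germ _ (E_regular a (Pr b))); near=> s; rewrite mxE.
    have rw : regular_at s0 (fun s => (\det (A s))^-1 *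
        \sum_(i < j) - E s j (r i) * (\adj (A s)) i (Ordinal cj)).
      apply: regular_mul; first by apply: regular_inv => //; exact: regular_det.
      apply: regular_sum => i _; apply: regular_mul; last exact: regular_adj.
      by apply: regular_opp; exact: E_regular.
    apply: (regular_germ _ rw); near=> s.
    rewrite nth_mkseq// /wn insubT !mxE; congr (_ * _).
    by apply: eq_bigr => i _; rewrite !mxE.
  have w0 : GRing.eval (mkseq (wn s0) j) t != 0.
    apply/eqP => w0; apply: sol0; exists u0; split=> //.
    by rewrite (wE s0)// .
  have wnear := regular_neq0 wreg w0.
  near=> s => /=.
  have [Ps ds] : (forall i, P s (r i)) /\ \det (A s) != 0 by near: s.
  case=> [|[u [us ut]]]; first by apply; exact: indep_of_minor ds.
  have : GRing.eval (mkseq (wn s) j) t != 0 by near: s.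
  by rewrite -(wE s u)// ut eqxx.
(* A relation with nonzero coefficient at [j] could be normalised, against [nosol]; one with zero
   coefficient there contradicts [ind0]. *)
have ind1 : indep (P s0) (E s0) j.+1.
  move=> v vs; have vj : v j = 0.
    apply/eqP; apply: contra_notT nosol => vj; exists (fun c => v c / v j) => p Pp.
    apply: (mulfI vj); rewrite mulr0 -[RHS](vs p Pp).
    rewrite (ext_sum _ (fun c => E s0 c p)) big_ord_recr mulrDr.
    congr (_ + _); rewrite mulr_sumr; apply: eq_bigr => c _.
    by rewrite mulrA [v j * _]mulrC divfK.
  move=> c; rewrite ltnS leq_eqVlt => /predU1P[->//|]; apply: ind0 => p Pp.
  by rewrite -[RHS](vs p Pp) big_ord_recr /= vj mul0r addr0.
have [r1 [Pr1 rdet1]] := indep_minor ind1.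
have r1near := minor_near Pr1 rdet1.
near=> s => /=.
have [Ps ds] : (forall i, P s (r1 i)) /\
  \det (\matrix_(c < j.+1, i < j.+1) E s c (r1 i)) != 0 by near: s.
have inds := indep_of_minor Ps ds.
case=> [|[u [us _]]]; first by apply; exact: indep_leq inds.
have /eqP := inds _ us j (ltnSn j).
by rewrite /ext ltnn oner_eq0.
Unshelve. all: by end_near. Qed.

End LinearSystems.

(** * Charts and birational representatives *)

Section Slices.
Variables (k : fieldType) (S X : kspace k).

(** The topology is finer than the product topology, so slices need an argument: a tensor [h]
    restricted to either slice is a regular function, and its nonvanishing is open. *)
Lemma near_slice (s : S) (x : X) (P : prod_kspace S X -> Prop) :
  (\forall p \near ((s, x) : prod_kspace S X), P p) ->
  (\forall s' \near s, P (s', x)) /\ (\forall x' \near x, P (s, x')).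
Proof.
rewrite {1}/prop_near1 nbhsE => -[W [oW Wsx] WP].
have [U [V [h [[oU Us oV Vx] [n [a [b [ra rb hE]]]] hsx hW]]]] := oW _ Wsx.
have Un : \forall s' \near s, U s' by apply: open_nbhs_nbhs.
have Vn : \forall x' \near x, V x' by apply: open_nbhs_nbhs.
split.
  have hn : \forall s' \near s, h (s', x) != 0.
    apply: regular_neq0 hsx; have rs : regular_at s (fun s' => \sum_(i < n) a i s' * b i x).
      by apply: regular_sum => i _; apply: regular_mul; [exact: ra|exact: regular_cst].
    by apply: (regular_germ _ rs); near=> s'; rewrite hE.
  by near=> s'; apply/WP/hW => //=; near: s'.
have hn : \forall x' \near x, h (s, x') != 0.
  apply: regular_neq0 hsx; have rx : regular_at x (fun x' => \sum_(i < n) a i s * b i x').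
    by apply: regular_sum => i _; apply: regular_mul; [exact: regular_cst|exact: rb].
  by apply: (regular_germ _ rx); near=> x'; rewrite hE.
by near=> x'; apply/WP/hW => //=; near: x'.
Unshelve. all: by end_near. Qed.

Lemma regular_slice (s : S) (x : X) (F : prod_kspace S X -> k) :
  regular_at ((s, x) : prod_kspace S X) F -> regular_at s (fun s' => F (s', x)).
Proof.
move=> [U [V [g [h [[oU Us oV Vx] [n [a [b [ra rb gE]]]] [m [c [d [rc rd hE]]]] hsx FE]]]]].
have rg : regular_at s (fun s' => \sum_(i < n) a i s' * b i x).
  by apply: regular_sum => i _; apply: regular_mul; [exact: ra|exact: regular_cst].
have rh : regular_at s (fun s' => \sum_(i < m) c i s' * d i x).
  by apply: regular_sum => i _; apply: regular_mul; [exact: rc|exact: regular_cst].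
have rq : regular_at s (fun s' => (\sum_(i < n) a i s' * b i x) *
    (\sum_(i < m) c i s' * d i x)^-1).
  by apply: regular_mul => //; apply: regular_inv => //; rewrite -(hE (s, x)).
apply: (regular_germ _ rq); have [Fn _] := near_slice FE.
by apply: filterS Fn => s' ->; rewrite gE hE.
Qed.

End Slices.

Section Irreducible.
Variables (X : topologicalType) (irr : irreducible X).

Lemma irreducible_meet (U V : set X) : open U -> open V ->
  U !=set0 -> V !=set0 -> (U `&` V) !=set0.
Proof.
move=> oU oV [x Ux] [y Vy]; apply: contrapT => UV.
have := irr.2 _ _ (open_closedC oU) (open_closedC oV).
rewrite -setCI; case=> [|E|E].
- by apply/seteqP; split=> // z _ UVz; apply: UV; exists z.
- by have : (~` U) x by rewrite E.
- by have : (~` V) y by rewrite E.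
Qed.

Lemma irreducible_dense (U : set X) : open U -> U !=set0 -> dense U.
Proof. by move=> oU U0 V V0 oV; exact: irreducible_meet. Qed.

End Irreducible.

Definition chart (k : fieldType) (X : kspace k) (Y : set X) n (y : 'I_n -> X -> k) :=
  [/\ open Y, Y !=set0, forall l x, Y x -> regular_at x (y l) &
      forall x x', Y x -> Y x' -> (forall l, y l x = y l x') -> x = x'].

Lemma variety_chart (k : fieldType) (X : kspace k) : is_variety X ->
  irreducible X -> exists (Y : set X) n (y : 'I_n -> X -> k), chart Y y.
Proof.
move=> [[m [U [oaU Ucov]]] _] [[x0 _] _].
have [i _ Ux0] : (\bigcup_i U i) x0 by rewrite Ucov.
have [oU aU] := oaU i.
have [n [tau [tau_inj tau_reg _ _ _]]] := is_affine_embedding aU.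
(* The coordinates become total functions by the value 0 off the chart; regularity is claimed on the
   chart only. *)
pose y l x := if pselect (U i x) is left h
  then (tau (exist _ x (mem_set h)) : 'rV[k]_n) 0 l else 0.
have yE l (z : U i) : y l (set_val z) = (tau z : 'rV[k]_n) 0 l.
  rewrite /y; case: pselect => [h|]; last by case; exact: set_valP.
  by congr ((tau _ : 'rV[k]_n) 0 l); exact: val_inj.
exists (U i), n, y; split=> //; first by exists x0.
- move=> l x Ux; have [G [rG GE]] := tau_reg (exist _ x (mem_set Ux)) l.
  move: GE; rewrite {1}/prop_near1 nbhsE => -[B [[A oA AB] Bx] BG].
  apply: (regular_germ _ rG) => /=.
  have Ax : A x by move: Bx; rewrite -AB.
  have An : \forall z \near x, A z by apply: open_nbhs_nbhs.
  have Un : \forall z \near x, U i z by apply: open_nbhs_nbhs.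
  near=> z; have Uz : U i z by near: z.
  have Az : A z by near: z.
  have := BG (exist _ z (mem_set Uz)); rewrite -AB => /(_ Az) <-.
  by rewrite -yE.
- move=> x x' Ux Ux' yxx'.
  suff : tau (exist _ x (mem_set Ux)) = tau (exist _ x' (mem_set Ux')).
    by move=> /tau_inj[].
  by apply/rowP => l; rewrite -!yE; exact: yxx'.
Unshelve. all: by end_near. Qed.

Section Representatives.
Variables (k : fieldType) (X Z : kspace k).

Lemma represented_open (alpha : ratmap X Z) U f : represented_by alpha U f -> open U.
Proof. by move=> [r [_ <- _]]; exact: rdom_open. Qed.

Lemma represented_agree (alpha : ratmap X Z) U f U' f' :
  represented_by alpha U f -> represented_by alpha U' f' ->
  exists W, [/\ open W, dense W, W `<=` U `&` U' & forall x, W x -> f x = f' x].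
Proof.
move=> [r [rE rU rf]] [r' [r'E rU' rf']].
have /eqmodP/asboolP[W [oW dW WU WE]] : \pi_(ratmap X Z)%qT r = \pi_(ratmap X Z)%qT r'.
  by rewrite rE r'E.
move: WU; rewrite rU rU' => WU.
exists W; split=> // x Wx; have [Ux Ux'] := WU _ Wx.
by rewrite -rf// -rf'// WE.
Qed.

Lemma represented_eq (alpha beta : ratmap X Z) U f U' f' W : irreducible X ->
  represented_by alpha U f -> represented_by beta U' f' ->
  open W -> W !=set0 -> W `<=` U `&` U' -> (forall x, W x -> f x = f' x) ->
  alpha = beta.
Proof.
move=> irr [r [<- rU rf]] [r' [<- rU' rf']] oW W0 WU ff'.
apply/eqmodP/asboolP; exists W; rewrite rU rU'; split=> //.
  exact: irreducible_dense.
by move=> x Wx; have [Ux Ux'] := WU _ Wx; rewrite rf// rf'// ff'.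
Qed.

Lemma represented_morphism (alpha : ratmap X Z) U f : represented_by alpha U f ->
  morphism_on U f.
Proof.
move=> [r [_ rU rf]] x Ux.
have Un : \forall z \near x, f z = rfun r z.
  have Uz : \forall z \near x, U z.
    by apply: open_nbhs_nbhs; split=> //; rewrite -rU; exact: rdom_open.
  by near=> z; rewrite rf//; near: z.
have [|rc rr] := @rfun_morphism _ _ _ r x; first by rewrite rU.
have fx := nbhs_singleton Un.
split.
  move=> B; rewrite fx => Bfx.
  have Bn : \forall z \near x, B (rfun r z) by exact: rc.
  suff : \forall z \near x, B (f z) by [].
  near=> z; have -> : f z = rfun r z by near: z.
  by near: z.
move=> g; rewrite fx => /rr; apply: regular_germ.
by near=> z => /=; congr (g _); apply/esym; near: z.
Unshelve. all: by end_near. Qed.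

End Representatives.

(** For nonemptiness, [Y] meets the dense image of an isomorphism representing [g], and any other
    representative agrees with that one on a dense open set. *)
Lemma bir_preimage (k : fieldType) (X : kspace k) (g : Bir X) U f (Y : set X) :
  represented_by (sval g) U f -> open Y -> Y !=set0 ->
  open [set x | U x /\ Y (f x)] /\ [set x | U x /\ Y (f x)] !=set0.
Proof.
have o U' f' : represented_by (sval g) U' f' -> open Y ->
    open [set x | U' x /\ Y (f' x)].
  move=> gf oY; rewrite openE => x [Ux Yfx]; have [fc _] := represented_morphism gf Ux.
  have Yn : \forall z \near x, Y (f' z) by apply: fc; exact: open_nbhs_nbhs.
  have Un : \forall z \near x, U' z.
    by apply: open_nbhs_nbhs; split=> //; exact: represented_open gf.
  by near=> z; split; near: z.
move=> gf oY [y0 Yy0]; split; first exact: o.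
have [U' [f' [V' [g' [gf' [oV' dV' _] _ VU]]]]] := svalP g.
have [y [Yy Vy]] := dV' Y (ex_intro _ y0 Yy0) oY.
have [W [oW dW WU ff']] := represented_agree gf gf'.
have [Ugy fgy] := VU _ Vy.
have [|x [[U'x Yx] Wx]] := dW _ _ (o _ _ gf' oY).
  by exists (g' y); split=> //; rewrite fgy.
by exists x; have [Ux _] := WU _ Wx; split=> //; rewrite ff'.
Unshelve. all: by end_near. Qed.

(** * Linear relations satisfied by a birational map *)

Section BirRelations.
Variables (k : fieldType) (X : kspace k).
Hypothesis irr : irreducible X.
Variables (Y : set X) (n : nat) (y : 'I_n -> X -> k).
Hypothesis Yy : chart Y y.
Variables (V : set X) (gam : nat -> X -> option 'I_n -> k).
Hypotheses (oV : open V) (V0 : V !=set0).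
Hypothesis gam_regular : forall c x o, V x -> regular_at x (fun z => gam c z o).

Implicit Types u v : nat -> k.

(** The contribution of [gam c] to numerator minus [y_l] times denominator, where index [Some l]
    stands for the [l]-th numerator and [None] for the common denominator. *)
Definition defect (f : X -> X) c (r : X * 'I_n) :=
  gam c r.1 (Some r.2) - y r.2 (f r.1) * gam c r.1 None.

(** Quantifying over all representatives makes this a condition on [g] alone. *)
Definition bir_relation (g : Bir X) j u :=
  forall U f, represented_by (sval g) U f ->
  forall r, U r.1 -> V r.1 -> Y (f r.1) -> \sum_(c < j) u c * defect f c r = 0.

Lemma bir_domain (g : Bir X) U f : represented_by (sval g) U f ->
  open [set x | [/\ U x, V x & Y (f x)]] /\
  [set x | [/\ U x, V x & Y (f x)]] !=set0.
Proof.
move=> gf; have [oY Y0 _ _] := Yy; have [oP P0] := bir_preimage gf oY Y0.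
have -> : [set x | [/\ U x, V x & Y (f x)]] = [set x | U x /\ Y (f x)] `&` V.
  by apply/seteqP; split=> [x []|x [[]]].
by split; [exact: openI|exact: irreducible_meet].
Qed.

(** The left-hand side of the relation is a regular function; if it were nonzero at a point, it
    would be nonzero on an open set, which meets [O] by irreducibility. *)
Lemma bir_relation_local (g : Bir X) U f O j u : represented_by (sval g) U f ->
  open O -> O !=set0 -> (forall x, O x -> [/\ U x, V x & Y (f x)]) ->
  (forall x l, O x -> \sum_(c < j) u c * defect f c (x, l) = 0) ->
  bir_relation g j u.
Proof.
move=> gf oO O0 Osub Oeq U' f' gf' [x l] /= Ux Vx Yx; apply: contrapT => /eqP Fx.
have [_ _ yreg _] := Yy.
have rF : regular_at x (fun z => \sum_(c < j) u c * defect f' c (z, l)).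
  apply: regular_sum => c _; apply: regular_mul; first exact: regular_cst.
  rewrite /defect /=; apply: regular_add; first exact: gam_regular.
  apply: regular_opp; apply: regular_mul; last exact: gam_regular.
  by have [_ ] := represented_morphism gf' Ux; apply; exact: yreg.
have := regular_neq0 rF Fx; rewrite {1}/prop_near1 nbhsE => -[B [oB Bx] BF].
have [W [oW dW WU ff']] := represented_agree gf gf'.
have OW := dW _ O0 oO.
have [z [Bz [Oz Wz]]] := irreducible_meet irr oB (openI oO oW) (ex_intro _ x Bx) OW.
have := BF _ Bz; rewrite /= -[X in X != _]/(\sum_(c < j) u c * defect f' c (z, l)).
have -> : \sum_(c < j) u c * defect f' c (z, l) = 0.
  by rewrite -[RHS](Oeq z l Oz); apply: eq_bigr => c _; rewrite /defect /= ff'.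
by rewrite eqxx.
Qed.

Lemma defect_sum (f : X -> X) j u x l : \sum_(c < j) u c * defect f c (x, l) =
  \sum_(c < j) u c * gam c x (Some l) - y l (f x) * \sum_(c < j) u c * gam c x None.
Proof.
rewrite mulr_sumr -sumrB; apply: eq_bigr => c _.
by rewrite /defect /= mulrBr mulrCA.
Qed.

(* A nonzero relation reads [p_l = (y_l \o g) * q] with [q != 0], hence
   determines the functions [y_l \o g], and so [g]. *)
Lemma bir_relation_inj K j u (g h : Bir X) c0 :
  indep [set r : X * option 'I_n | V r.1] (fun c r => gam c r.1 r.2) K ->
  (j <= K)%N -> (c0 < j)%N -> u c0 != 0 ->
  bir_relation g j u -> bir_relation h j u -> g = h.
Proof.
move=> indK jK cj uc gu hu; have [_ _ yreg yinj] := Yy.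
have [[U [f [_ [_ [gf _ _ _]]]]] [U' [f' [_ [_ [hf' _ _ _]]]]]] := (svalP g, svalP h).
have sreg x o : V x -> regular_at x (fun z => \sum_(c < j) u c * gam c z o).
  move=> Vx; apply: regular_sum => c _; apply: regular_mul; first exact: regular_cst.
  exact: gam_regular.
have [x1 [o [Vx1 x1o]]] : exists x o, V x /\ \sum_(c < j) u c * gam c x o != 0.
  apply: contrapT => nx; have := indep_leq jK indK.
  move=> /(_ u) /(_ _ c0 cj) u0; move/eqP: uc; apply; apply: u0 => -[x o] /= Vx.
  by apply: contrapT => /eqP xo; apply: nx; exists x, o.
have := regular_neq0 (sreg _ _ Vx1) x1o.
rewrite {1}/prop_near1 nbhsE => -[B [oB Bx1] BF].
have [oD D0] := bir_domain gf.
have [x2 [Bx2 [Ux2 Vx2 Yx2]]] := irreducible_meet irr oB oD (ex_intro _ x1 Bx1) D0.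
(* Some entry of the combination is nonzero at [x2]; if it is a numerator, the relation makes it a
   multiple of the denominator. *)
have x2N : \sum_(c < j) u c * gam c x2 None != 0.
  have := BF _ Bx2; rewrite /=; case: o {x1o BF} => [l|//].
  have := gu U f gf (x2, l) Ux2 Vx2 Yx2; rewrite defect_sum => /eqP.
  by rewrite subr_eq0 => /eqP ->; rewrite mulf_eq0 negb_or => /andP[].
have := regular_neq0 (sreg _ _ Vx2) x2N.
rewrite {1}/prop_near1 nbhsE => -[B' [oB' B'x2] B'F].
have [oD' D'0] := bir_domain hf'.
pose W := B' `&` [set x | [/\ U x, V x & Y (f x)]] `&` [set x | [/\ U' x, V x & Y (f' x)]].
have oW : open W by apply: openI => //; exact: openI.
have W0 : W !=set0.
  apply: irreducible_meet => //; first exact: openI.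
  by exists x2; split.
have ff' x : W x -> f x = f' x.
  move=> [[B'x [Ux Vx Yx]] [U'x _ Y'x]]; apply: yinj => // l.
  have qx : \sum_(c < j) u c * gam c x None != 0 := B'F _ B'x.
  have := gu U f gf (x, l) Ux Vx Yx; rewrite defect_sum => /subr0_eq E1.
  have := hu U' f' hf' (x, l) U'x Vx Y'x; rewrite defect_sum => /subr0_eq E2.
  by apply: (mulIf qx); rewrite -E1 -E2.
have gh : sval g = sval h.
  apply: (represented_eq irr gf hf' oW W0) => // x [[_ [Ux _ _]] [U'x _ _]].
  by split.
case: g h gh {gu hu gf hf'} => [a pa] [b pb] /= ab; case: _ / ab in pb *.
by congr exist; exact: Prop_irrelevance.
Qed.

(** * Relations along an algebraic family of birational maps *)

Section Families.
Variables (S : kspace k) (psi : S -> Bir X).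
Variables (U : set (prod_kspace S X)) (f : prod_kspace S X -> X).
Hypotheses (oU : open U) (mf : morphism_on U f).
Hypothesis psi_f : forall s,
  represented_by (sval (psi s)) (fiber U s) (fun x => f (s, x)).

Definition row_dom s : set (X * 'I_n) := [set r | [/\ U (s, r.1), V r.1 & Y (f (s, r.1))]].
Definition row_entry s c r := defect (fun x => f (s, x)) c r.

Lemma row_dom_near s0 r : row_dom s0 r -> \forall s \near s0, row_dom s r.
Proof.
move=> [Us Vr Yf]; have [oY _ _ _] := Yy.
have Un : \forall p \near ((s0, r.1) : prod_kspace S X), U p by exact: open_nbhs_nbhs.
have Yn : \forall p \near ((s0, r.1) : prod_kspace S X), Y (f p).
  by have [fc _] := mf Us; apply: fc; exact: open_nbhs_nbhs.
have [Un' _] := near_slice Un; have [Yn' _] := near_slice Yn.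
by near=> s; split=> //; near: s.
Unshelve. all: by end_near. Qed.

Lemma row_entry_regular s0 r c : row_dom s0 r ->
  regular_at s0 (fun s => row_entry s c r).
Proof.
move=> [Us Vr Yf]; have [_ _ yreg _] := Yy.
apply: regular_add; first exact: regular_cst.
apply: regular_opp; apply: regular_mul; last exact: regular_cst.
have [_ fr] := mf Us.
exact: (regular_slice (fr _ (yreg r.2 _ Yf))).
Qed.

(** This identifies the intrinsic relations of [psi s] with a linear system varying regularly in
    [s]; one representative suffices by [bir_relation_local]. *)
Lemma bir_relation_family s j u :
  bir_relation (psi s) j u <-> relation row_dom row_entry s j u.
Proof.
split=> [su r [Us Vr Yf]|su]; first exact: su (psi_f s) _ _ _ _.
have [oD D0] := bir_domain (psi_f s).
by apply: (bir_relation_local (psi_f s) oD D0) => // x l [Ux Vx Yx]; exact: su.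
Qed.

End Families.

Definition bir_indep g j := forall u, bir_relation g j u ->
  forall c, (c < j)%N -> u c = 0.

(** Closedness in [Bir X] is tested on families, where it becomes [solution_closed]. *)
Lemma bir_solution_closed j (t : GRing.term k) : GRing.rterm t ->
  closed [set g | ~ bir_indep g j \/ exists u,
    bir_relation g j.+1 (ext u j) /\ GRing.eval (mkseq u j) t = 0].
Proof.
move=> rt; apply/bir_closedP => S _ psi [_ [U [f [[[oU _] _ mf _ _] psi_f]]]].
have := solution_closed (row_dom_near oU mf) (row_entry_regular mf) (j := j) rt.
congr closed; apply/seteqP; split=> s [nind|[u [us ut]]] /=.
- by left => ind; apply: nind => u us; apply: ind; apply/(bir_relation_family psi_f).
- by right; exists u; split=> //; apply/(bir_relation_family psi_f).
- by left => ind; apply: nind => u us; apply: ind; apply/(bir_relation_family psi_f).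
- by right; exists u; split=> //; apply/(bir_relation_family psi_f).
Qed.

(** The difference of two normalised relations has no term at [j], so it is a relation among the
    first [j] functions. *)
Lemma bir_solution_unique g j u v : bir_indep g j ->
  bir_relation g j.+1 (ext u j) -> bir_relation g j.+1 (ext v j) ->
  mkseq u j = mkseq v j.
Proof.
move=> ind gu gv; apply/eq_in_map => c; rewrite mem_iota add0n => /= cj.
apply/eqP; rewrite -subr_eq0; apply/eqP.
apply: (ind (fun c => u c - v c)) cj => U f gf r Ur Vr Yr.
have := gu U f gf r Ur Vr Yr; have := gv U f gf r Ur Vr Yr.
rewrite !(ext_sum _ (fun c => defect f c r)).
move=> /eqP; rewrite addr_eq0 => /eqP Ev /eqP; rewrite addr_eq0 => /eqP Eu.
by under eq_bigr do rewrite mulrBl; rewrite sumrB Eu Ev subrr.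
Qed.

(** The first [j] entries of [u] are determined by [g], so this is the preimage under [g |-> u] of
    the set defined by [F], on the stratum of index [j]. *)
Definition stratum j (F : GRing.formula k) : set (Bir X) :=
  [set g | bir_indep g j /\ exists u,
    bir_relation g j.+1 (ext u j) /\ GRing.qf_eval (mkseq u j) F].

(** Induction on [F]. Equations come from the closed sets [Z t], and by uniqueness of the solution
    negation becomes the complement inside the whole stratum. *)
Lemma stratum_constructible j F : GRing.qf_form F -> GRing.rformula F ->
  constructible (stratum j F).
Proof.
pose Z t := [set g | ~ bir_indep g j \/ exists u,
  bir_relation g j.+1 (ext u j) /\ GRing.eval (mkseq u j) t = 0].
(* The equation 1 = 0 has no solution, so only the degenerate alternative of [Z] remains. *)
have Z1 : Z (GRing.Const 1) = [set g | ~ bir_indep g j].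
  apply/seteqP; split=> g; last by left.
  by case=> // -[u [_ /eqP]]; rewrite oner_eq0.
have cZ t : GRing.rterm t -> constructible (Z t `&` ~` Z (GRing.Const 1)).
  move=> rt; apply: constructibleI; first exact/constructible_closed/bir_solution_closed.
  exact/constructible_open/closed_openC/bir_solution_closed.
have ZE t F' : (forall e, GRing.qf_eval e F' = (GRing.eval e t == 0)) ->
    stratum j F' = Z t `&` ~` Z (GRing.Const 1).
  move=> F'E; rewrite Z1; apply/seteqP.
  split=> [g [ind [u [gu]]]|g [[//|[u [gu ut]]] /contrapT ind]].
    by rewrite F'E => /eqP ut; split; [right; exists u|].
  by split=> //; exists u; rewrite F'E ut.
have cT : constructible (stratum j (GRing.Bool true)).
  rewrite (ZE (GRing.Const 0)); first exact: cZ.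
  by move=> e; rewrite /= eqxx.
have cN F' G : (forall e, GRing.qf_eval e G = ~~ GRing.qf_eval e F') ->
    constructible (stratum j F') -> constructible (stratum j G).
  move=> GE cF'; suff -> : stratum j G = stratum j (GRing.Bool true) `&` ~` stratum j F'.
    by apply: constructibleI cT _; exact: constructibleC.
  apply/seteqP; split=> [g [ind [u [gu uG]]]|g [[ind [u [gu _]]] nF]].
    split; first by split=> //; exists u.
    move=> [_ [v [gv vF]]]; move: uG; rewrite GE.
    by rewrite (bir_solution_unique ind gu gv) vF.
  split=> //; exists u; split=> //; rewrite GE; apply/negP => uF.
  by apply: nF; split=> //; exists u.
have cU F1 F2 G : (forall e, GRing.qf_eval e G = GRing.qf_eval e F1 || GRing.qf_eval e F2) ->
    constructible (stratum j F1) -> constructible (stratum j F2) ->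
    constructible (stratum j G).
  move=> GE c1 c2; suff -> : stratum j G = stratum j F1 `|` stratum j F2.
    exact: constructibleU.
  apply/seteqP; split=> [g [ind [u [gu]]]|g [[ind [u [gu uF]]]|[ind [u [gu uF]]]]].
  - by rewrite GE => /orP[uF|uF]; [left|right]; split=> //; exists u.
  - by split=> //; exists u; rewrite GE uF.
  - by split=> //; exists u; rewrite GE uF orbT.
elim: F => //=.
- move=> [] _ _ //; suff -> : stratum j (GRing.Bool false) = set0 by exact: constructible0.
  by apply/seteqP; split=> // g [_ [u []]].
- move=> t1 t2 _ /andP[rt1 rt2].
  rewrite (ZE (GRing.Add t1 (GRing.Opp t2))); first by apply: cZ => /=; rewrite rt1.
  by move=> e /=; rewrite subr_eq0.
- move=> F1 IH1 F2 IH2 /andP[q1 q2] /andP[r1 r2].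
  apply: (cN (GRing.Or (GRing.Not F1) (GRing.Not F2))) => [e /=|].
    by rewrite negb_or !negbK.
  apply: (cU (GRing.Not F1) (GRing.Not F2)) => //.
    by apply: (cN F1) => //; exact: IH1.
  by apply: (cN F2) => //; exact: IH2.
- move=> F1 IH1 F2 IH2 /andP[q1 q2] /andP[r1 r2].
  by apply: (cU F1 F2) => //; [exact: IH1|exact: IH2].
- move=> F1 IH1 F2 IH2 /andP[q1 q2] /andP[r1 r2].
  apply: (cU (GRing.Not F1) F2) => [e /=| |]; first by rewrite implybE.
    by apply: (cN F1) => //; exact: IH1.
  exact: IH2.
- by move=> F IHF qF rF; apply: (cN F) => //; exact: IHF.
Qed.

End BirRelations.

(** * Definability over an affine base *)

Section DefinableRelations.
Variables (k : closedFieldType) (T : kspace k) (N : nat).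
Variables (tau : T -> affine_point k N).
Hypothesis tauE : affine_embedding tau.

Lemma definable_constructible (C : set T) (rho : 'I_N -> nat) : constructible C ->
  definable (fun a => exists2 t, C t & tau t = \row_i a (rho i)).
Proof.
have [tau_inj _ [Z ZE] clE _] := tauE.
have clD (F : set T) : closed F ->
    definable (fun a => exists2 t, F t & tau t = \row_i a (rho i)).
  move=> /clE[S SE].
  apply: definable_ext
    (definable_and (definable_zero_locus Z rho) (definable_zero_locus S rho)).
  move=> e; split=> [[/ZE[t te] St]|[t Ft te]].
    by exists t => //; apply/SE; rewrite te.
  by rewrite -te; split; [apply/ZE; exists t|apply/SE].
move=> [m [L [lcL ->]]]; elim: m => [|m IHm] in L lcL *.
  apply: definable_ext (definable_bool k false) => e.
  by split=> // -[t [[]]].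
have [U [F [oU cF LE]]] := lcL ord0.
have IH := IHm (fun i => L (lift ord0 i)) (fun i => lcL _).
(* Membership in the open [U] is expressed as lying on [T] but not in the closed complement;
   injectivity of [tau] makes this faithful. *)
have UD := definable_and (clD _ closedT) (definable_not (clD _ (open_closedC oU))).
apply: definable_ext (definable_or (definable_and UD (clD _ cF)) IH) => e.
split=> [[[[[t _ te] nU] [s Fs se]]|[t [i _ Lt] te]]|[t [i _ Lt] te]].
- have ts : t = s by apply: tau_inj; rewrite te.
  exists t => //; exists ord0 => //; rewrite LE; split; last by rewrite ts.
  by apply: contrapT => nUt; apply: nU; exists t.
- by exists t => //; exists (lift ord0 i).
- have [i' ii'|i0] := unliftP ord0 i; [right|left].
    by exists t => //; exists i' => //; rewrite -ii'.
  move: Lt; rewrite i0 LE => -[Ut Ft]; split; last by exists t.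
  split; first by exists t.
  by move=> [s nUs se]; apply: nUs; rewrite (tau_inj s t)// se.
Qed.

Variables (R : Type) (P : T -> set R) (E : T -> nat -> R -> k).
Hypothesis P_near : forall t0 r, P t0 r -> \forall t \near t0, P t r.
Hypothesis E_regular : forall t0 r c, P t0 r -> regular_at t0 (fun t => E t c r).

(** Denominators are multiplied together, starting from a polynomial whose nonvanishing already
    ensures [P t r]. *)
Lemma common_denominator j t0 r : P t0 r -> exists (p : nat -> mpoly.mpoly N k) q,
  peval q (tau t0) != 0 /\ forall t, peval q (tau t) != 0 ->
    P t r /\ forall c, (c < j)%N -> E t c r = peval (p c) (tau t) / peval q (tau t).
Proof.
have [_ _ _ clE reg] := tauE.
move=> Pr; elim: j => [|j [p [q [q0 qE]]]].
  have [q q0 qE] := closed_near clE (P_near Pr).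
  by exists (fun=> 0), q; split=> // t /qE.
have [p' [q' [q'0 q'E]]] := reg _ _ (E_regular j Pr).
exists (fun c => if c == j then p' * q else p c * q'), (q * q').
rewrite pevalM mulf_neq0//; split=> // t.
rewrite pevalM mulf_eq0 negb_or => /andP[qt q't]; have [Pt Et] := qE t qt; split=> // c.
rewrite ltnS leq_eqVlt; case: eqVneq => [->|_] /= cj.
  by rewrite !pevalM q'E// [peval q _ * _]mulrC -mulf_div divff// mulr1.
by rewrite !pevalM Et// -mulf_div divff// mulr1.
Qed.

Definition joint_point j (u : nat -> k) t : affine_point k (N + j) :=
  (\row_(i < N + j) match fintype.split i with
    | inl a => (tau t : 'rV[k]_N) 0 a
    | inr c => u c
    end : 'rV[k]_(N + j)).

(** Take all polynomials vanishing on the solution set. Conversely, each equation at a point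
    [(t, r)], with denominators cleared, yields such a polynomial. *)
Lemma relation_zero_locus j : exists S : set (mpoly.mpoly (N + j) k),
  forall t u, relation P E t j u <-> zero_locus S (joint_point j u t).
Proof.
exists [set p | forall t u, relation P E t j u -> peval p (joint_point j u t) = 0].
move=> t u; split=> [tu p|tu r Pr]; first exact.
have [p [q [q0 qE]]] := common_denominator j Pr.
pose lift (p : mpoly.mpoly N k) : mpoly.mpoly (N + j) k :=
  mpoly.comp_mpoly [tuple mpoly.mpolyX k (mpoly.mnm1 (lshift j i)) | i < N] p.
have liftE p' s v : peval (lift p') (joint_point j v s) = peval p' (tau s).
  rewrite /peval mpoly.comp_mpoly_meval; apply: mpoly.meval_eq => i.
  by rewrite tnth_mktuple mpoly.mevalXU mxE (unsplitK (inl _ i)).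
(* The extra factor [q] makes [Q] vanish where [q] does, since [r] need not give an equation
   there. *)
pose Q : mpoly.mpoly (N + j) k := lift q *
  \sum_(c < j) mpoly.mpolyX k (mpoly.mnm1 (rshift N c)) * lift (p c).
have QE s v : peval Q (joint_point j v s) =
    peval q (tau s) * \sum_(c < j) v c * peval (p c) (tau s).
  rewrite pevalM liftE; congr (_ * _); rewrite /peval rmorph_sum /=.
  apply: eq_bigr => c _; rewrite rmorphM /= -/(peval (lift (p c)) _) liftE.
  by rewrite mpoly.mevalXU mxE (unsplitK (inr _ c)).
have sumE s v : peval q (tau s) != 0 -> \sum_(c < j) v c * peval (p c) (tau s) =
    peval q (tau s) * \sum_(c < j) v c * E s c r.
  move=> qs; have [_ Es] := qE s qs; rewrite mulr_sumr; apply: eq_bigr => c _.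
  by rewrite Es// mulrCA [_ * (_ / _)]mulrC divfK.
have : peval Q (joint_point j u t) = 0.
  apply: tu => s v sv; rewrite QE.
  have [->|qs] := eqVneq (peval q (tau s)) 0; first by rewrite mul0r.
  by rewrite sumE// sv ?mulr0//; have [] := qE s qs.
by rewrite QE sumE// => /eqP; rewrite !mulf_eq0 (negPf q0) /= => /eqP.
Qed.

End DefinableRelations.

(** * Uniform denominators *)

Section BoundedDenominators.
Variables (k : fieldType) (X T : kspace k).
Hypothesis irr : irreducible X.
Variables (Y : set X) (n : nat) (y : 'I_n -> X -> k).
Hypothesis Yy : chart Y y.
Variables (phi : T -> Bir X) (U : set (prod_kspace T X)) (f : prod_kspace T X -> X).
Hypotheses (oU : open U) (mf : morphism_on U f).
Hypothesis phi_f : forall t,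
  represented_by (sval (phi t)) (fiber U t) (fun x => f (t, x)).

(* [y_l (f (t, x)) = h x (Some l) / h x None] on a nonempty open set, with [h]
   in the span of [F] *)
Definition fraction_in_span (I : finType) (F : I -> X -> option 'I_n -> k) (t : T) :=
  exists (a : I -> k) (O : set X), [/\ open O, O !=set0 &
    forall x, O x -> [/\ U (t, x), Y (f (t, x)),
      \sum_i a i * F i x None != 0 &
      forall l, \sum_i a i * F i x (Some l) =
        y l (f (t, x)) * \sum_i a i * F i x None]].

Lemma fraction_in_span_inl (I J : finType) (F : I -> X -> option 'I_n -> k)
    (G : J -> X -> option 'I_n -> k) t : fraction_in_span F t ->
  fraction_in_span (fun i : I + J => match i with inl i => F i | inr j => G j end) t.
Proof.
move=> [a [O [oO O0 OE]]].
pose b (i : I + J) := match i with inl i => a i | inr j => 0 end.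
exists b, O; split=> // x Ox.
have bE o : \sum_i b i * (match i with inl i => F i | inr j => G j end) x o =
    \sum_i a i * F i x o.
  by rewrite big_sumType /= [X in _ + X]big1 ?addr0// => j _; rewrite mul0r.
have [Ux Yx nx lx] := OE x Ox.
by split; rewrite ?bE// => l; rewrite !bE.
Qed.

Lemma fraction_in_span_inr (I J : finType) (F : I -> X -> option 'I_n -> k)
    (G : J -> X -> option 'I_n -> k) t : fraction_in_span G t ->
  fraction_in_span (fun i : I + J => match i with inl i => F i | inr j => G j end) t.
Proof.
move=> [a [O [oO O0 OE]]].
pose b (i : I + J) := match i with inl i => 0 | inr j => a j end.
exists b, O; split=> // x Ox.
have bE o : \sum_i b i * (match i with inl i => F i | inr j => G j end) x o =
    \sum_i a i * G i x o.
  by rewrite big_sumType /= [X in X + _]big1 ?add0r// => j _; rewrite mul0r.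
have [Ux Yx nx lx] := OE x Ox.
by split; rewrite ?bE// => l; rewrite !bE.
Qed.

(** Each [y_l \o f] is locally a quotient of tensors; the finitely many denominators are merged one
    coordinate at a time. *)
Lemma tensor_common_denominator (p : prod_kspace T X) : U p -> Y (f p) ->
  exists (A : set T) (B : set X) (g : 'I_n -> prod_kspace T X -> k) h,
    [/\ [/\ open A, A p.1, open B & B p.2], forall l, tensor A B (g l),
      tensor A B h, h p != 0 &
      \forall q \near p, forall l, h q != 0 /\ y l (f q) = g l q / h q].
Proof.
move=> Up Yp; have [_ _ yreg _] := Yy.
suff H (s : seq 'I_n) : exists (A : set T) (B : set X)
    (g : 'I_n -> prod_kspace T X -> k) h,
    [/\ [/\ open A, A p.1, open B & B p.2], forall l, tensor A B (g l),
      tensor A B h, h p != 0 &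
      \forall q \near p, forall l, l \in s -> h q != 0 /\ y l (f q) = g l q / h q].
  have [A [B [g [h [AB tg th hp E]]]]] := H (enum 'I_n).
  exists A, B, g, h; split=> //; apply: filterS E => q qE l.
  by apply: qE; rewrite mem_enum.
elim: s => [|l s [A [B [g [h [[oA Ap oB Bp] tg th hp hE]]]]]].
  exists setT, setT, (fun=> fun=> 0), (fun=> 1); split; rewrite ?oner_eq0//.
  - by split=> //; exact: openT.
  - by move=> _; exact: tensor_cst.
  - exact: tensor_cst.
  - by near=> q.
have [_ fr] := mf Up.
have [A' [B' [g' [h' [[oA' Ap' oB' Bp'] tg' th' hp' h'E]]]]] := fr _ (yreg l _ Yp).
have sub Q : tensor A B Q -> tensor (A `&` A') (B `&` B') Q.
  by apply: tensorS => z [].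
have sub' Q : tensor A' B' Q -> tensor (A `&` A') (B `&` B') Q.
  by apply: tensorS => z [].
exists (A `&` A'), (B `&` B').
exists (fun i q => if i == l then g' q * h q else g i q * h' q).
exists (fun q => h q * h' q); split; rewrite ?mulf_neq0//.
- by split=> //; exact: openI.
- by move=> i; case: (i == l); apply: tensorM; auto.
- by apply: tensorM; auto.
have hn := tensor_neq0 oA Ap oB Bp th hp.
have hn' := tensor_neq0 oA' Ap' oB' Bp' th' hp'.
near=> q => i.
have [_ _ hq] : [/\ A q.1, B q.2 & h q != 0] by near: q.
have [_ _ hq'] : [/\ A' q.1, B' q.2 & h' q != 0] by near: q.
have yl : (y l \o f) q = g' q / h' q by near: q.
have ys : forall l, l \in s -> h q != 0 /\ y l (f q) = g l q / h q by near: q.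
rewrite in_cons mulf_neq0//; case: eqVneq => [-> _|_ /= /ys[_ ->]]; split=> //.
  by rewrite -[y l (f q)]/((y l \o f) q) yl [h q * _]mulrC -mulf_div divff// mulr1.
by rewrite -mulf_div divff// mulr1.
Unshelve. all: by end_near. Qed.

(** Numerators and denominator are finite sums of products [a(t) b(x)]. For fixed [t] they are
    combinations of the same functions [b], with coefficients [a(t)]. *)
Lemma local_span (t0 : T) : exists (V : set X) (I : finType) (F : I -> X -> option 'I_n -> k),
  [/\ open V, V !=set0, forall i x o, V x -> regular_at x (fun z => F i z o) &
    \forall t \near t0, fraction_in_span F t].
Proof.
have [oY Y0 _ _] := Yy.
have [_ [x0 [Ux0 Yx0]]] := bir_preimage (phi_f t0) oY Y0.
pose p : prod_kspace T X := (t0, x0).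
have [A [B [g [h [[oA Ap oB Bp] tg th hp hE]]]]] := @tensor_common_denominator p Ux0 Yx0.
pose G o := if o is Some l then g l else h.
have tG o : tensor A B (G o) by case: o.
pose no o := projT1 (cid (tG o)).
have [a [b [ra rb GE]]] : exists (a : forall o, 'I_(no o) -> T -> k)
      (b : forall o, 'I_(no o) -> X -> k),
    [/\ forall o i t, A t -> regular_at t (a o i),
        forall o i x, B x -> regular_at x (b o i) &
        forall o q, G o q = \sum_(i < no o) a o i q.1 * b o i q.2].
  pose ao o := projT1 (cid (projT2 (cid (tG o)))).
  pose bo o := projT1 (cid (projT2 (cid (projT2 (cid (tG o)))))).
  exists ao, bo; split=> o; rewrite /ao /bo /no;
    by case: (cid (projT2 (cid (projT2 (cid (tG o)))))) => b [].
pose I : finType := {o : option 'I_n & 'I_(no o)}.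
(* Each [b] sits in its own position [o] and is 0 in the others, so one coefficient family serves
   the denominator and all numerators. *)
pose F (i : I) x o := if o == tag i then b (tag i) (tagged i) x else 0.
have FE t o x : \sum_(i : I) a (tag i) (tagged i) t * F i x o = G o (t, x).
  transitivity (\sum_(o' : option 'I_n) \sum_(m < no o')
      a o' m t * (if o == o' then b o' m x else 0)).
    by rewrite (sig_big_dep (fun=> true) (fun _ _ => true)
      (fun o' m => a o' m t * (if o == o' then b o' m x else 0))).
  rewrite GE (bigD1 o)//= eqxx [X in _ + X]big1 ?addr0// => o' /negPf o'o.
  by apply: big1 => m _; rewrite eq_sym o'o mulr0.
exists B, I, F; split=> //; first by exists x0.
  move=> i x o Bx; rewrite /F; case: (o == _); last exact: regular_cst.
  exact: rb.
have hn := tensor_neq0 oA Ap oB Bp th hp.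
have Un : \forall q \near p, U q by exact: open_nbhs_nbhs.
have Yn : \forall q \near p, Y (f q).
  by have [fc _] := mf Ux0; apply: fc; exact: open_nbhs_nbhs.
have : \forall q \near p, [/\ U q, Y (f q), h q != 0 &
    forall l, g l q = y l (f q) * h q].
  near=> q; have [_ _ hq] : [/\ A q.1, B q.2 & h q != 0] by near: q.
  split=> //; [by near: q|by near: q|move=> l].
  have qE : forall l, h q != 0 /\ y l (f q) = g l q / h q by near: q.
  by have [_ ->] := qE l; rewrite divfK.
rewrite {1}/prop_near1 nbhsE => -[W [oW Wp] WE].
have Wn : \forall q \near p, W q by exact: open_nbhs_nbhs.
have [Wt _] := near_slice Wn.
apply: filterS Wt => t Wt.
exists (fun i => a (tag i) (tagged i) t), [set x | W (t, x)]; split.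
- rewrite openE => x Wx.
  have Wxn : \forall q \near ((t, x) : prod_kspace T X), W q by exact: open_nbhs_nbhs.
  by have [] := near_slice Wxn.
- by exists x0.
- move=> x Wx; have [Ux Yx hx gE] := WE _ Wx.
  by split; rewrite ?FE// => l; rewrite !FE; exact: gE.
Unshelve. all: by end_near. Qed.

(** Quasi-compactness leaves finitely many local families; their disjoint union works on the
    intersection of their domains, nonempty by irreducibility of [X]. *)
Lemma global_span : is_affine T ->
  exists (V : set X) (I : finType) (F : I -> X -> option 'I_n -> k),
  [/\ open V, V !=set0, forall i x o, V x -> regular_at x (fun z => F i z o) &
    forall t, fraction_in_span F t].
Proof.
move=> affT.
pose Vt t := projT1 (cid (local_span t)).
pose It t := projT1 (cid (projT2 (cid (local_span t)))).
pose Ft t := projT1 (cid (projT2 (cid (projT2 (cid (local_span t)))))).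
have VIF t : [/\ open (Vt t), Vt t !=set0,
    forall i x o, Vt t x -> regular_at x (fun z => Ft t i z o) &
    \forall s \near t, fraction_in_span (Ft t) s].
  exact: (projT2 (cid (projT2 (cid (projT2 (cid (local_span t))))))).
have near_t t : \forall s \near t, fraction_in_span (Ft t) s by have [] := VIF t.
have [l lE] := affine_quasi_compact affT near_t.
have [V [I [F [oV V0 rF FE]]]] : exists (V : set X) (I : finType)
    (F : I -> X -> option 'I_n -> k), [/\ open V, V !=set0,
    forall i x o, V x -> regular_at x (fun z => F i z o) &
    forall s t, t \in l -> fraction_in_span (Ft t) s -> fraction_in_span F s].
  elim: l {lE} => [|t l [V [I [F [oV V0 rF FE]]]]].
    exists setT, void, (fun=> fun=> fun=> 0); split=> //; first exact: openT.
    by have [x _] := irr.1; exists x.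
  have [oVt Vt0 rFt _] := VIF t.
  exists (Vt t `&` V), (It t + I)%type.
  exists (fun i => match i with inl i => Ft t i | inr j => F j end); split.
  - exact: openI.
  - exact: irreducible_meet.
  - by move=> [i|i] x o [Vtx Vx]; [exact: rFt|exact: rF].
  - move=> s t'; rewrite in_cons => /predU1P[->|t'l Fs].
      exact: fraction_in_span_inl.
    exact/fraction_in_span_inr/(FE s t').
exists V, I, F; split=> // t; have [t' t'l /FE] := lE t; exact.
Qed.

Lemma uniform_relations : is_affine T ->
  exists (V : set X) (gam : nat -> X -> option 'I_n -> k) K,
  [/\ open V, V !=set0, forall c x o, V x -> regular_at x (fun z => gam c z o),
    indep [set r : X * option 'I_n | V r.1] (fun c r => gam c r.1 r.2) K &
    forall t, exists u, (exists2 c, (c < K)%N & u c != 0) /\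
      bir_relation Y y V gam (phi t) K u].
Proof.
move=> /global_span[V [I [F [oV V0 rF FE]]]].
pose G i (r : X * option 'I_n) :=
  if insub i is Some j then F (enum_val (j : 'I_#|I|)) r.1 r.2 else 0.
have GE (i : I) r : G (enum_rank i) r = F i r.1 r.2.
  rewrite /G insubT//= => h; congr (F _ _ _); rewrite -[RHS]enum_rankK.
  by congr enum_val; exact: val_inj.
have rG c x o : V x -> regular_at x (fun z => G c (z, o)).
  move=> Vx; rewrite /G; case: insubP => [i _ _|_]; last exact: regular_cst.
  exact: rF.
have [K [s [_ sind sspan]]] := exists_indep_span [set r : X * option 'I_n | V r.1] G #|I|.
exists V, (fun c x o => G (s c) (x, o)), K; split=> //.
  by move=> c x o Vx; exact: rG.
move=> t; have [a [O [oO O0 OE]]] := FE t.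
have /choice[w wE] : forall i : I, exists u : nat -> k, forall r, V r.1 ->
    F i r.1 r.2 = \sum_(c < K) u c * G (s c) r.
  by move=> i; have [u uE] := sspan _ (ltn_ord (enum_rank i)); exists u => r /uE; rewrite GE.
pose v (c : nat) := \sum_i a i * w i c.
have vE x o : V x -> \sum_(c < K) v c * G (s c) (x, o) = \sum_i a i * F i x o.
  move=> Vx; under eq_bigr do rewrite mulr_suml.
  rewrite exchange_big /=; apply: eq_bigr => i _.
  by rewrite (wE i (x, o) Vx) mulr_sumr; apply: eq_bigr => c _; rewrite mulrA.
have [x [Ox Vx]] := irreducible_meet irr oO oV O0 V0.
exists v; split.
  (* If all coefficients were zero, so would be the denominator, which is nonzero at [x]. *)
  apply: contrapT => nv; have [_ _ + _] := OE x Ox.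
  rewrite -(vE x None Vx) big1 ?eqxx// => c _.
  suff -> : v c = 0 by rewrite mul0r.
  by apply: contrapT => /eqP vc; apply: nv; exists c.
apply: (bir_relation_local irr Yy (fun c x o => @rG (s c) x o) (phi_f t) (openI oO oV)).
- by exists x.
- by move=> z [/OE[? ? _ _] ?]; split.
- move=> z l [Oz Vz]; rewrite defect_sum !vE//; have [_ _ _ ->] := OE z Oz.
  by rewrite subrr.
Qed.

End BoundedDenominators.

(** * Images of constructible sets *)

Lemma relation_eq (k : fieldType) (S : kspace k) (R : Type) (P : S -> set R)
    (E : S -> nat -> R -> k) s j (u v : nat -> k) :
  (forall c, (c < j)%N -> u c = v c) ->
  relation P E s j u -> relation P E s j v.
Proof.
move=> uv su r Pr; rewrite -[RHS](su r Pr).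
by apply: eq_bigr => c _; rewrite uv.
Qed.

(** Quantify existentially over the coordinates of [t] in the condition that [t] lies in [C] and
    satisfies the relation, then eliminate quantifiers. *)
Lemma definable_solutions (k : closedFieldType) (T : kspace k) N
    (tau : T -> affine_point k N) (R : Type) (P : T -> set R)
    (E : T -> nat -> R -> k) (C : set T) j :
  affine_embedding tau ->
  (forall t0 r, P t0 r -> \forall t \near t0, P t r) ->
  (forall t0 r c, P t0 r -> regular_at t0 (fun t => E t c r)) ->
  constructible C ->
  exists F : GRing.formula k, [/\ GRing.qf_form F, GRing.rformula F &
    forall u, GRing.qf_eval (mkseq u j) F <->
      exists2 t, C t & relation P E t j.+1 (ext u j)].
Proof.
move=> tauE P_near E_regular cC.
have [S SE] := relation_zero_locus tauE P_near E_regular j.+1.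
(* Variables below [j] hold [u], variable [j] holds the constant 1, and the next [N] hold the
   coordinates of [t]. *)
pose rho (i : 'I_N) := (j.+1 + i)%N.
pose sigma (i : 'I_(N + j.+1)) :=
  match fintype.split i with inl a => rho a | inr c => c : nat end.
have def1 : definable (fun a : nat -> k => a j = 1).
  by exists (GRing.Equal (GRing.Var k j) (GRing.Const 1)).
(* The quantified block consists of variable [j] and the [N] coordinates, hence its length
   [N.+1]. *)
have defP := definable_exists (iota j N.+1) (definable_and def1 (definable_and
  (definable_constructible tauE rho cC) (definable_zero_locus S sigma))).
have [F [qF rF FE]] := definable_qf defP.
exists F; split=> // u; rewrite FE.
have jointE t (e : seq k) : tau t = \row_i e`_(rho i) ->
    joint_point tau j.+1 (nth 0 e) t = \row_i e`_(sigma i).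
  move=> te; apply/rowP => i; rewrite !mxE /sigma.
  by case: (fintype.split i) => // a; rewrite te mxE.
split=> [[e eu [ej [[t Ct te] Se]]]|[t Ct tu]].
  exists t => //; have /SE : zero_locus S (joint_point tau j.+1 (nth 0 e) t).
    by rewrite jointE.
  apply: relation_eq => c; rewrite ltnS leq_eqVlt /ext => /predU1P[->|cj].
    by rewrite ltnn.
  by rewrite cj -eu ?nth_mkseq// mem_iota leqNgt cj.
pose e := mkseq (ext u j) j.+1 ++ [seq (tau t : 'rV[k]_N) 0 i | i <- enum 'I_N].
have eE c : (c < j.+1)%N -> e`_c = ext u j c.
  by move=> cj; rewrite nth_cat size_mkseq cj nth_mkseq.
have te : tau t = \row_i e`_(rho i).
  apply/rowP => i; rewrite mxE nth_cat size_mkseq /rho ltnNge leq_addr /=.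
  by rewrite addKn (nth_map i) ?size_enum_ord// nth_ord_enum.
exists e.
  move=> i; rewrite mem_iota negb_and -ltnNge -leqNgt => /orP[ij|ij].
    by rewrite nth_mkseq// eE ?(ltn_trans ij)// /ext ij.
  have se : size e = (j + N.+1)%N.
    by rewrite size_cat size_mkseq size_map size_enum_ord addSnnS.
  by rewrite !nth_default ?se ?size_mkseq// (leq_trans _ ij)// leq_addr.
split; first by rewrite eE// /ext ltnn.
split; first by exists t.
rewrite -(jointE t)//; apply/SE; apply: relation_eq tu => c cj.
by rewrite eE.
Qed.

Theorem theorem34 (k : closedFieldType) (X T : kspace k)
  (X_variety : is_variety X) (X_irreducible : irreducible X)
  (X_rational : is_rational X)
  (T_affine : is_affine T) (T_irreducible : irreducible T)
  (phi : T -> Bir X) (phi_morphism : bir_morphism phi)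
  (C : set T) (C_constructible : constructible C) :
  constructible (phi @` C) /\
  exists V : set (Bir X),
    [/\ V `<=` phi @` C,
        exists2 O : set (Bir X), open O & V = O `&` closure (phi @` C) &
        closure (phi @` C) `<=` closure V].
Proof.
suff cphiC : constructible (phi @` C).
  by split=> //; exact: constructible_dense_open.
have [Y [n [y Yy]]] := variety_chart X_variety X_irreducible.
have [_ [U [f [[[oU _] _ mf _ _] phi_f]]]] := phi_morphism.
have [V [gam [K [oV V0 rgam ind phi_rel]]]] :=
  uniform_relations X_irreducible Yy oU mf phi_f T_affine.
have [N [tau tauE]] := is_affine_embedding T_affine.
have relE := bir_relation_family X_irreducible Yy oV V0 rgam phi_f.
have /choice[F FP] : forall j, exists F : GRing.formula k,
    [/\ GRing.qf_form F, GRing.rformula F &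
    forall u, GRing.qf_eval (mkseq u j) F <->
      exists2 t, C t & bir_relation Y y V gam (phi t) j.+1 (ext u j)].
  move=> j; have [F [qF rF FE]] := definable_solutions j tauE
    (row_dom_near Yy oU mf) (@row_entry_regular k X Y n y Yy V gam T U f mf) C_constructible.
  exists F; split=> // u; rewrite FE.
  by split=> -[t Ct tu]; exists t => //; apply/relE.
have -> : phi @` C = \bigcup_(j < K) stratum Y y V gam j (F j).
  apply/seteqP; split=> [_ [t Ct <-]|g [j /= jK [gind [u [gu]]]]].
    have [w [[c cK wc] tw]] := phi_rel t.
    pose dep j := `[< ~ bir_indep Y y V gam (phi t) j >].
    have depK : dep K.
      by apply/asboolP => /(_ w tw c cK) wc0; rewrite wc0 eqxx in wc.
    (* The least dependent length is positive, as the empty family is independent; written [j.+1],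
       it gives independence at [j] and a relation ending at [j]. *)
    have [[|j] /asboolP depj jmin] := ex_minnP (ex_intro _ K depK).
      by case: depj.
    have indj : bir_indep Y y V gam (phi t) j.
      by apply: contrapT => nindj; have := jmin j (introT (asboolP _) nindj); rewrite ltnn.
    exists j; first exact: jmin depK.
    split=> //.
    have [v [tv vj]] : exists v, bir_relation Y y V gam (phi t) j.+1 v /\ v j != 0.
      apply: contrapT => nv; apply: depj => v tv.
      have vj : v j = 0 by apply: contrapT => /eqP vj; apply: nv; exists v.
      move=> c'; rewrite ltnS leq_eqVlt => /predU1P[->//|].
      apply: indj => U' f' tf r U'r Vr Yr.
      by rewrite -[RHS](tv U' f' tf r U'r Vr Yr) big_ord_recr /= vj mul0r addr0.
    exists (fun c => v c / v j).
    have tvj : bir_relation Y y V gam (phi t) j.+1 (ext (fun c => v c / v j) j).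
      move=> U' f' tf r U'r Vr Yr; rewrite (ext_sum _ (fun c => defect y gam f' c r)).
      apply: (mulfI vj); rewrite mulr0 -[RHS](tv U' f' tf r U'r Vr Yr).
      rewrite big_ord_recr /= mulrDr mulr_sumr; congr (_ + _).
      by apply: eq_bigr => c' _; rewrite mulrA [v j * _]mulrC divfK.
    by split=> //; have [_ _ ->] := FP j; exists t.
  (* Conversely, [g] shares the relation [ext u j] with some [phi t], [t] in [C]; its coefficient 1
     at [j] is nonzero, so the two maps coincide. *)
  have [_ _ ->] := FP j; move=> [t Ct tu]; exists t => //.
  apply: (bir_relation_inj X_irreducible Yy oV V0 rgam ind jK (ltnSn j) _ tu gu).
  by rewrite /ext ltnn oner_eq0.
apply: constructible_bigcup => j _; have [qF rF _] := FP j.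
exact: stratum_constructible.
Qed.
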